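(* Let $n \geq 3$ and let $p$ be an odd prime. Let $$X_{n,p} = \mathcal{CC}\big(\mathrm{SL}_{n+1}(\mathbb{F}_p[t]), \{K_i\}_{0\le i\le n}\big).$$ Then for every group $\Lambda$ that does not have non-trivial elements of order $p$, $H^1(X_{n,p},\Lambda)=0$.
   Context: **Coset complexes.** For a group $\Gamma$ with subgroups $K_0,\dots,K_n$, the coset complex $\mathcal{CC}(\Gamma, \{K_i\}_{0\le i\le n})$ is the partite simplicial complex with vertices the cosets $gK_i$ ($g\in\Gamma$, $0\le i\le n$; cosets with different indices $i$ are regarded as different vertices), where $\{g_{i_0}K_{i_0},\dots,g_{i_k}K_{i_k}\}$ is a $k$-simplex ($0\le k\le n$) if and only if $0\le i_0<\dots<i_k\le n$ and $g_{i_j}K_{i_j}\cap g_{i_l}K_{i_l}\neq\emptyset$ for all $0\le j,l\le k$. **The subgroups $K_i$.** For $r\in \mathbb{F}_p[t]$ and $1\le i\ne j\le n+1$, $e_{i,j}(r)$ is the $(n+1)\times(n+1)$ matrix with $1$'s on the diagonal, $r$ in entry $(i,j)$ and $0$ elsewhere. Let $\gamma_0$ be the cyclic permutation $(1\,2\,\dots\,n+1)$ of $\{1,\dots,n+1\}$ (so $1\mapsto 2\mapsto\cdots\mapsto n+1\mapsto 1$). For $0\le i\le n$ let $K_i<\mathrm{SL}_{n+1}(\mathbb{F}_p[t])$ be the subgroup generated by all $e_{\gamma_0^i(j),\gamma_0^i(j+1)}(r)$ with $1\le j\le n$, $r\in\mathbb{F}_p[t]$, $\deg r\le 3$. **Cohomology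 with coefficients in a (possibly non-abelian) group $\Lambda$.** For a simplicial complex $X$, $X(k)$ is the set of $k$-simplices and $X_{\mathrm{ord}}(k)$ the set of ordered $k$-simplices. $C^0(X,\Lambda)=\{\psi:X(0)\to\Lambda\}$; $C^1(X,\Lambda)=\{\phi:X_{\mathrm{ord}}(1)\to\Lambda:\phi((u,v))=\phi((v,u))^{-1}\}$. $Z^1(X,\Lambda)$ is the set of $\phi\in C^1(X,\Lambda)$ with $\phi((u,v))\phi((v,w))\phi((w,u))=e_\Lambda$ for all $(u,v,w)\in X_{\mathrm{ord}}(2)$. $B^1(X,\Lambda)$ is the set of $\phi\in C^1(X,\Lambda)$ of the form $\phi((u,v))=\psi(u)\psi(v)^{-1}$ for some $\psi\in C^0(X,\Lambda)$. $H^1(X,\Lambda)$ is the set of orbits of $Z^1(X,\Lambda)$ under the action of $C^0(X,\Lambda)$ given by $(\psi.\phi)((u,v))=\psi(u)\phi((u,v))\psi(v)^{-1}$. ''$H^1(X,\Lambda)=0$'' means $H^1(X,\Lambda)$ consists only of the orbit of the constant cocycle $e_\Lambda$; equivalently $Z^1(X,\Lambda)=B^1(X,\Lambda)$. *)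

(* Defs.v *)
From HB Require Import structures.
From mathcomp Require Import all_boot all_order all_algebra all_fingroup.
From mathcomp Require Import finmap.
From mathcomp Require Import boolp classical_sets.

Set Implicit Arguments.
Unset Strict Implicit.
Unset Printing Implicit Defensive.

Import GRing.Theory.

Local Open Scope classical_set_scope.
Local Open Scope fset_scope.
Local Open Scope ring_scope.

Record simplicial_complex (V : choiceType) := SimplicialComplex {
  simplices : set {fset V};
  simplices_neq0 : forall S, simplices S -> S != fset0;
  simplices_sub : forall S T, simplices S -> T `<=` S -> T != fset0 ->
    simplices T }.

Section Cochains.
Variables (V : choiceType) (X : simplicial_complex V).

(* $X(0)$, with a 0-simplex $\{v\}$ identified with the vertex $v$ *)
Definition vertices : set V := [set v | simplices X [fset v]].

(* $X_{\mathrm{ord}}(k)$ *)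
Definition ordered_simplices (k : nat) : set (k.+1.-tuple V) :=
  [set t | uniq t /\ simplices X [fset v in (t : seq V)]].
Arguments ordered_simplices k : clear implicits.

Lemma subvertex_subproof k (t : ordered_simplices k) (i : 'I_k.+1) :
  tnth (val t) i \in vertices.
Proof.
case: t => t /= /set_mem[_ Xt]; apply/mem_set/(simplices_sub Xt).
  by apply/fsubsetP => x; rewrite !inE => /eqP ->; apply: mem_tnth.
by apply/fset0Pn; exists (tnth t i); rewrite inE.
Qed.

Lemma subedge_subproof k (t : ordered_simplices k) (i j : 'I_k.+1) :
  i != j -> [tuple tnth (val t) i; tnth (val t) j] \in ordered_simplices 1.
Proof.
case: t => t /= /set_mem[ut Xt] ij; apply/mem_set; split.
  rewrite /= andbT inE; apply: contra ij.
  by move/tuple_uniqP: ut => tI /eqP /tI ->.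
apply: (simplices_sub Xt).
  by apply/fsubsetP => x; rewrite !inE orbF => /orP[] /eqP ->; apply: mem_tnth.
by apply/fset0Pn; exists (tnth t i); rewrite !inE eqxx.
Qed.

(* For $t = (v_0, \dots, v_k)$, the vertex $v_i$ and the edge $(v_i, v_j)$ *)
Definition subvertex k (t : ordered_simplices k) (i : 'I_k.+1) : vertices :=
  SigSub (subvertex_subproof t i).
Definition subedge k (t : ordered_simplices k) (i j : 'I_k.+1) (ij : i != j) :
    ordered_simplices 1 :=
  SigSub (subedge_subproof t ij).

Definition source (e : ordered_simplices 1) : vertices :=
  subvertex e (@Ordinal 2 0 isT).
Definition target (e : ordered_simplices 1) : vertices :=
  subvertex e (@Ordinal 2 1 isT).
Definition reverse (e : ordered_simplices 1) : ordered_simplices 1 :=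
  @subedge 1 e (@Ordinal 2 1 isT) (@Ordinal 2 0 isT) isT.
Definition edge01 (t : ordered_simplices 2) : ordered_simplices 1 :=
  @subedge 2 t (@Ordinal 3 0 isT) (@Ordinal 3 1 isT) isT.
Definition edge12 (t : ordered_simplices 2) : ordered_simplices 1 :=
  @subedge 2 t (@Ordinal 3 1 isT) (@Ordinal 3 2 isT) isT.
Definition edge20 (t : ordered_simplices 2) : ordered_simplices 1 :=
  @subedge 2 t (@Ordinal 3 2 isT) (@Ordinal 3 0 isT) isT.

Section Coefficients.
Local Open Scope group_scope.
Variable L : groupType.

Definition cochain0 := vertices -> L.

Definition cochain1 : set (ordered_simplices 1 -> L) :=
  [set phi | forall e : ordered_simplices 1, phi e = (phi (reverse e))^-1].

Definition cocycle1 : set (ordered_simplices 1 -> L) :=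
  [set phi | cochain1 phi /\ forall t : ordered_simplices 2,
    phi (edge01 t) * phi (edge12 t) * phi (edge20 t) = 1].

Definition gauge (psi : cochain0) (phi : ordered_simplices 1 -> L) :
    ordered_simplices 1 -> L :=
  fun e => psi (source e) * phi e * (psi (target e))^-1.

Definition gauge_orbit (phi : ordered_simplices 1 -> L) :
    set (ordered_simplices 1 -> L) :=
  [set gauge psi phi | psi in [set: cochain0]].

Definition cohomology1 : set (set (ordered_simplices 1 -> L)) :=
  [set gauge_orbit phi | phi in cocycle1].

Definition cohomology1_trivial : Prop :=
  cohomology1 = [set gauge_orbit (fun=> 1)].

End Coefficients.
End Cochains.

Section Groups.
Local Open Scope group_scope.
Variable G : groupType.

Definition subgroup (H : set G) : Prop :=
  [/\ H 1, forall x y, H x -> H y -> H (x * y) & forall x, H x -> H x^-1].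

Definition generated (S : set G) : set G := smallest subgroup S.

Definition left_coset (g : G) (H : set G) : set G := [set g * h | h in H].

Definition has_order (x : G) (m : nat) : Prop :=
  [/\ (0 < m)%N, x ^+ m = 1 & forall k, (0 < k < m)%N -> x ^+ k <> 1].

End Groups.

Section CosetComplex.
Variables (G : groupType) (n : nat) (K : 'I_n.+1 -> set G).

(* The index is part of the vertex, so that cosets with different indices are
   different vertices even if they are equal as sets. *)
Definition coset_vertex (g : G) (i : 'I_n.+1) : 'I_n.+1 * set G :=
  (i, left_coset g (K i)).

(* J is $\{i_0 < \dots < i_k\}$ *)
Definition coset_simplices : set {fset 'I_n.+1 * set G} :=
  [set S | exists (J : {set 'I_n.+1}) (g : 'I_n.+1 -> G),
    [/\ J != finset.set0,
        forall i j, i \in J -> j \in J ->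
          left_coset (g i) (K i) `&` left_coset (g j) (K j) !=set0
      & S = [fset coset_vertex (g i) i | i in J]]].

Lemma coset_simplices_neq0 S : coset_simplices S -> S != fset0.
Proof.
move=> [J [g [/finset.set0Pn[i Ji] _ ->]]].
by apply/fset0Pn; exists (coset_vertex (g i) i); apply: in_imfset.
Qed.

Lemma coset_simplices_sub S T :
  coset_simplices S -> T `<=` S -> T != fset0 -> coset_simplices T.
Proof.
move=> [J [g [_ gJ ->]]] /fsubsetP TS /fset0Pn[v Tv].
pose J' := finset [pred i in J | coset_vertex (g i) i \in T].
exists J', g; split.
- have /imfsetP[i /= Ji vE] := TS _ Tv.
  by apply/finset.set0Pn; exists i; rewrite finset.inE /= Ji -vE.
- by move=> i j; rewrite !finset.inE => /andP[Ji _] /andP[Jj _]; apply: gJ.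
- apply/fsetP => w; apply/idP/imfsetP => /= [Tw|[i]].
    have /imfsetP[i /= Ji wE] := TS _ Tw.
    by exists i; rewrite // finset.inE /= Ji -wE.
  by rewrite finset.inE => /andP[_ ?] ->.
Qed.

Definition coset_complex : simplicial_complex ('I_n.+1 * set G)%type :=
  SimplicialComplex coset_simplices_neq0 coset_simplices_sub.

End CosetComplex.

Section SpecialLinear.
Variables (R : comNzRingType) (m : nat).

Record SL := MakeSL { SL_mx :> 'M[R]_m; SL_det : \det SL_mx == 1 }.

HB.instance Definition _ := [isSub for SL_mx].
HB.instance Definition _ := [Choice of SL by <:].

Fact SL_one_subproof : \det (1%:M : 'M[R]_m) == 1.
Proof. by rewrite det1. Qed.

Fact SL_mul_subproof (A B : SL) : \det (A *m B) == 1.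
Proof. by rewrite det_mulmx (eqP (SL_det A)) (eqP (SL_det B)) mulr1. Qed.

Fact SL_inv_subproof (A : SL) : \det (\adj A) == 1.
Proof.
have := congr1 determinant (mul_mx_adj A).
by rewrite (eqP (SL_det A)) det_mulmx det1 (eqP (SL_det A)) mul1r => ->.
Qed.

Definition SL_one := MakeSL SL_one_subproof.
Definition SL_mul (A B : SL) := MakeSL (SL_mul_subproof A B).
(* the inverse is the adjugate since the determinant is 1 *)
Definition SL_inv (A : SL) := MakeSL (SL_inv_subproof A).

Fact SL_mulA : associative SL_mul.
Proof. by move=> A B C; apply: val_inj; apply: mulmxA. Qed.
Fact SL_mul1 : left_id SL_one SL_mul.
Proof. by move=> A; apply: val_inj; apply: mul1mx. Qed.
Fact SL_mulr1 : right_id SL_one SL_mul.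
Proof. by move=> A; apply: val_inj; apply: mulmx1. Qed.
Fact SL_mulV : left_inverse SL_one SL_inv SL_mul.
Proof.
by move=> A; apply: val_inj; rewrite /= mul_adj_mx (eqP (SL_det A)).
Qed.
Fact SL_mulrV : right_inverse SL_one SL_inv SL_mul.
Proof.
by move=> A; apply: val_inj; rewrite /= mul_mx_adj (eqP (SL_det A)).
Qed.

HB.instance Definition _ :=
  isGroup.Build SL SL_mulA SL_mul1 SL_mulr1 SL_mulV SL_mulrV.

Definition elementary_mx (i j : 'I_m) (r : R) : 'M[R]_m :=
  1%:M + r *: delta_mx i j.

Lemma det_elementary_mx i j r : i != j -> \det (elementary_mx i j r) == 1.
Proof.
move=> ij.
have liE a : (lift i a == i) = false by rewrite eq_sym (negPf (neq_lift i a)).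
pose C : 'M[R]_m := \matrix_(a, b) ((if a == i then j else a) == b)%:R.
rewrite (@determinant_multilinear _ _ _ 1%:M C i 1 r).
- rewrite det1 (@determinant_alternate _ _ C i j) ?mulr0 ?mulr1 ?addr0 // => b.
  by rewrite !mxE eqxx if_same.
- by apply/rowP => b; rewrite !mxE !eqxx mul1r /= (eq_sym j b).
- by apply/matrixP => a b; rewrite !mxE liE mulr0 addr0.
- by apply/matrixP => a b; rewrite !mxE liE ?mulr0 ?addr0.
Qed.

Definition elementary (i j : 'I_m) (ij : i != j) (r : R) : SL :=
  MakeSL (det_elementary_mx r ij).

End SpecialLinear.

Section Main.
Variables (n p : nat).

(* The index $j \in \{1, \dots, n+1\}$ is encoded as the ordinal $j - 1$; the
   cycle $(1\,2\,\dots\,n+1)$ is then the successor modulo $n+1$. *)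
Definition gamma0 : 'S_n.+1 := perm (@ordS_inj n.+1).

(* $j'$ is $j + 1$ for $1 \le j \le n$; [size r <= 4] is $\deg r \le 3$ *)
Definition K_generators (i : 'I_n.+1) : set (SL {poly 'F_p} n.+1) :=
  [set A | exists (j j' : 'I_n.+1) (r : {poly 'F_p})
      (jj' : (gamma0 ^+ i)%g j != (gamma0 ^+ i)%g j'),
    [/\ j' = j.+1 :> nat, (size r <= 4)%N & A = elementary jj' r]].

Definition K_ (i : 'I_n.+1) : set (SL {poly 'F_p} n.+1) :=
  generated (K_generators i).

Definition X_np := coset_complex K_.

End Main.

(* Main.v *)
From HB Require Import structures.
Require Import Defs.
From mathcomp Require Import all_boot all_order all_algebra all_fingroup.
From mathcomp Require Import cyclic finmap.
From mathcomp Require Import boolp classical_sets.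
From mathcomp Require Import zify ring.
(* Imported again, lest [generated] mean a subgroup of a finite group. *)
Import Defs.
Import GRing.Theory.

Set Implicit Arguments.
Unset Strict Implicit.
Unset Printing Implicit Defensive.

(** A cocycle on the coset complex defines a covering with fibre [L].  A lift of
    the chamber [h] to this covering can be transported to the chamber [h * g],
    for [g] in the subgroup [K_ i], by keeping its value at the common vertex
    [h * K_ i].  This lifts every [K_ i] to a group of automorphisms of the set
    of all lifted chambers, and the lifts agree on the intersections.  If the
    group generated by the lifted [K_ i] maps injectively to the special linear
    group, transport along it chooses compatible lifts of all chambers, and the
    cocycle is a coboundary ([cocycle_is_coboundary]).

    The automorphisms over the identity form a power of [L], which has no
    [p]-torsion.  So everything comes down to a statement about groups,
    [sections_injective]: let [f] be a morphism to the special linear group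
    over the polynomials, whose kernel has no [p]-torsion; if the [K_ i] have
    compatible lifts, then these generate a group which meets the kernel
    trivially.

    The kernel having no [p]-torsion is used as a uniqueness principle: two
    commuting elements of exponent [p] with the same image are equal
    ([commuting_lifts_eq]).  Let [x a b r] be the lift of the elementary matrix
    with entry [r] at [(a, b)], for [r] of degree at most 3.  Relations between
    two root elements which lie in a common [K_ i] are given.  For the other
    pairs, elements which should commute do so by
    [neighbour_commutators_commute], for which [p] has to be odd, and the other
    commutators are found by changing the middle index of a chain
    ([shift_commutator]) and by uniqueness.  The same two arguments define root
    elements of all degrees and prove the Steinberg relations between them
    ([steinberg_step], [steinberg_lift_of_monomials]).

    What remains is the triviality of the second K-group of the polynomials over
    a prime field, in the form [full_injective].  Over the prime field, the
    torus of diagonal matrices lifts because Steinberg symbols are trivial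
    ([symbol_trivial], [diag_mul]).  Over the polynomials, the root elements
    act on rows by elementary column operations, and division with remainder
    reduces rows.  Different reductions of a row agree up to the root elements
    which fix the unit row ([rep_move]); so these generate the stabilizer of
    the unit row ([full_stabilizer]), and an induction on the number of indices
    in use shows that the kernel is trivial. *)

(** * Subgroups and commutators *)

Section Subgroups.
Local Open Scope group_scope.
Variable G : groupType.
Implicit Types (S H : set G) (x y z : G).

Lemma generated_subgroup S : subgroup (generated S).
Proof.
split=> [H [[]]//|x y Sx Sy H HS|x Sx H HS].
  by case: (HS) => -[_ HM _] _; apply: HM; [apply: Sx | apply: Sy].
by case: (HS) => -[_ _ HV] _; apply: HV; apply: Sx.
Qed.

Lemma generated_gen S x : S x -> generated S x.
Proof. by move=> Sx H [_]; apply. Qed.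

Lemma generated1 S : generated S 1.
Proof. by case: (generated_subgroup S). Qed.

Lemma generatedM S x y : generated S x -> generated S y -> generated S (x * y).
Proof. by case: (generated_subgroup S) => _ + _; apply. Qed.

Lemma generatedV S x : generated S x -> generated S x^-1.
Proof. by case: (generated_subgroup S) => _ _; apply. Qed.

Lemma generatedX S x k : generated S x -> generated S (x ^+ k).
Proof.
move=> Sx; elim: k => [|k IH]; first exact: generated1.
by rewrite expgS; apply: generatedM.
Qed.

Lemma generated_min S H : subgroup H -> (forall x, S x -> H x) ->
  forall x, generated S x -> H x.
Proof. by move=> gH SH x; apply; split. Qed.

Lemma subgroup_centralizer x : subgroup [set y | commute x y].
Proof.
split=> [|y z|y]; [exact: commute1 | exact: commuteM | exact: commuteV].
Qed.

Lemma commuteVl x y : commute x y -> commute x^-1 y.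
Proof. by move=> xy; apply/commute_sym/commuteV/commute_sym. Qed.

Lemma commuteMl x y z : commute x z -> commute y z -> commute (x * y) z.
Proof. by move=> xz yz; apply/commute_sym/commuteM; apply: commute_sym. Qed.

Lemma commuteR x y z : commute x y -> commute x z -> commute x [~ y, z].
Proof.
move=> xy xz; rewrite /commg /conjg.
by do !apply: commuteM => //; apply: commuteV.
Qed.

Lemma conj_commute x y : commute x y -> x ^ y = x.
Proof. by move=> xy; rewrite conjgE xy mulKg. Qed.

Lemma commute_conj x y : x ^ y = x -> commute x y.
Proof. by move=> xy; rewrite /commute conjgC xy. Qed.

Lemma commXg x y n : commute x [~ x, y] -> [~ x ^+ n, y] = [~ x, y] ^+ n.
Proof.
move=> xR; rewrite commgEl conjXg.
have -> : x ^ y = x * [~ x, y] by rewrite commgEl mulVKg.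
by rewrite expgMn // mulKg.
Qed.

Lemma commMg x y z : [~ x * y, z] = [~ x, z] ^ y * [~ y, z].
Proof. by rewrite /commg /conjg !gnorm. Qed.

Lemma commgM x y z : [~ x, y * z] = [~ x, z] * [~ x, y] ^ z.
Proof. by rewrite /commg /conjg !gnorm. Qed.

Lemma commVg x y : [~ x^-1, y] = [~ x, y]^-1 ^ x^-1.
Proof. by rewrite /commg /conjg !gnorm. Qed.

Lemma commgV x y : [~ x, y^-1] = [~ x, y]^-1 ^ y^-1.
Proof. by rewrite /commg /conjg !gnorm. Qed.

Lemma commgMR x y : x ^ y = x * [~ x, y].
Proof. by rewrite commgEl mulVKg. Qed.

End Subgroups.

Section HallWitt.
Local Open Scope group_scope.
Variable G : groupType.
Variables a b c : G.

(** The Hall-Witt identity for commuting [a] and [c]: both commutators measure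
    how conjugation by [c] moves [[~ a, b]].  It lets a commutator change its
    middle index in a chain of root elements. *)
Lemma shift_commutator : commute a c -> commute [~ a, b] a ->
  commute [~ a, b] [~ b, c] ->
  [~ [~ a, b], c] = [~ a, [~ b, c]] /\ commute [~ a, b] [~ [~ a, b], c].
Proof.
set P := [~ a, b]; set Q := [~ b, c] => ac Pa PQ.
have PR : commute P [~ a, Q] by apply: commuteR.
have E : P * [~ P, c] = P * [~ a, Q].
  rewrite -commgMR {1}/P conjRg (conj_commute ac) commgMR -/Q commgM.
  by rewrite -/P (conj_commute PQ) PR.
by move/mulgI: E => ->.
Qed.

End HallWitt.

(** * Morphisms whose kernel has no p-torsion *)

Section TorsionFreeKernel.
Local Open Scope group_scope.
Variables (G H : groupType) (f : UMagmaMorphism.type G H) (p : nat).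

Definition kernel_has_no_torsion := forall z, f z = 1 -> z ^+ p = 1 -> z = 1.

Hypothesis f_tf : kernel_has_no_torsion.

(** The quotient of two commuting lifts of exponent [p] has exponent [p] and
    lies in the kernel. *)
Lemma commuting_lifts_eq x y : commute x y -> x ^+ p = 1 -> y ^+ p = 1 ->
  f x = f y -> x = y.
Proof.
move=> xy xp yp fxy; apply: divg1_eq; apply: f_tf.
  by rewrite gmulfF fxy divgg.
by rewrite expgnFl // xp yp divgg.
Qed.

(** Applied when [b] acts on [w] in the same way as [x] and as [y^-1]. *)
Lemma conj_transfer (w b x y : G) : commute x b -> commute y b ->
    w ^ b = w ^ x -> w ^ b = w ^ y^-1 ->
  [/\ commute w (x * y), commute w (x ^+ 2 * y ^+ 2) &
      commute w (x^-1 * y^-1)].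
Proof.
move=> xb yb wx wy.
have wb2 : w ^ (b ^+ 2) = w ^ (x ^+ 2).
  by rewrite expg2 conjgM wx -conjgM xb conjgM wx -conjgM.
have wb2' : w ^ (b ^+ 2) = w ^ (y ^+ 2)^-1.
  rewrite expg2 conjgM wy -conjgM (commuteVl yb) conjgM wy -conjgM.
  by rewrite expg2 invgM.
have wbV : w ^ b^-1 = w ^ x^-1.
  apply: (@conjg_inj _ b); rewrite conjgKV -conjgM (commuteVl xb) conjgM wx.
  by rewrite conjgK.
have wbV' : w ^ b^-1 = w ^ y.
  by apply: (@conjg_inj _ b); rewrite conjgKV -conjgM yb conjgM wy conjgKV.
split; apply: commute_conj; rewrite conjgM.
- by rewrite -wx wy conjgKV.
- by rewrite -wb2 wb2' conjgKV.
- by rewrite -wbV wbV' conjgK.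
Qed.

(** In the group of unipotent 4 x 4 matrices, presented by the relations
    between neighbouring root subgroups, the elements [x] and [y] stand for the
    entries (1,3) and (2,4).  Conjugating [b ^+ s] by [a ^+ r * c] in the two
    possible orders gives [x ^- (r * s) * (y ^+ s) ^ (a ^+ r) =
    y ^+ s * (x ^- (r * s)) ^ c]; call this element [w r s].  As [b] acts on the
    left side as [x ^+ r] and on the right side as [y^-1], [w r s] commutes
    with every [x ^+ (r * k) * y ^+ k].  Both [w 1 2] and [w 2 1] therefore
    commute with [k = x ^+ 2 * y * x ^- 2 * y^-1], and so does their quotient
    [y].  Now [k * y] is a conjugate of [y], so [k ^+ p = 1]; as [k] is in the
    kernel, it is trivial.  Finally [x] is a power of [x ^+ 2] as [p] is odd. *)
Lemma neighbour_commutators_commute (a b c x y : G) :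
  x = [~ a, b] -> y = [~ b, c] -> odd p -> commute a c -> commute x a -> commute x b -> commute y b ->
  commute y c -> x ^+ p = 1 -> y ^+ p = 1 -> commute (f x) (f y) ->
  commute x y.
Proof.
move=> xE yE' p_odd ac xa xb yb yc xp yp fxy.
have ba : b ^ a = b * x^-1 by rewrite commgMR -[[~ b, a]]invgR xE.
have bc : b ^ c = b * y by rewrite commgMR yE'.
have ab : a ^ b = a * x by rewrite commgMR xE.
have cb : c ^ b = c * y^-1 by rewrite commgMR -[[~ c, b]]invgR yE'.
have xV2 k : commute (x ^- 2) (x ^+ k) by apply: commuteVl; apply: commuteX2.
pose w1 := x ^- 2 * (y ^+ 2) ^ a; pose w2 := x ^- 2 * y ^ (a ^+ 2).
have w1E : w1 = y ^+ 2 * (x ^- 2) ^ c.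
  have b2a : (b ^+ 2) ^ a = b ^+ 2 * x ^- 2.
    rewrite conjXg ba expgMn ?expVgn //; exact/commute_sym/commuteVl.
  have b2c : (b ^+ 2) ^ c = b ^+ 2 * y ^+ 2.
    by rewrite conjXg bc expgMn //; apply: commute_sym.
  have : (b ^+ 2) ^ (a * c) = (b ^+ 2) ^ (c * a) by rewrite ac.
  rewrite !conjgM b2a b2c !(conjMg (b ^+ 2)) b2a b2c -!(mulgA (b ^+ 2)) => /(@mulgI _ (b ^+ 2)).
  by rewrite /w1 => <-.
have w2E : w2 = y * (x ^- 2) ^ c.
  have ba2 : b ^ (a ^+ 2) = b * x ^- 2.
    rewrite expg2 conjgM ba conjMg ba conjVg (conj_commute xa).
    by rewrite expg2 invgM mulgA.
  have : b ^ (a ^+ 2 * c) = b ^ (c * a ^+ 2).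
    by congr (_ ^ _); apply/commute_sym/commuteX/commute_sym.
  rewrite (conjgM b _ c) (conjgM b c) ba2 bc !(conjMg b) bc ba2 -!(mulgA b) => /(@mulgI _ b).
  by rewrite /w2 => <-.
have x2V_b : (x ^- 2) ^ b = x ^- 2.
  by apply/conj_commute/commuteVl/commute_sym/commuteX/commute_sym.
have yk_b k : (y ^+ k) ^ b = y ^+ k.
  by apply/conj_commute/commute_sym/commuteX/commute_sym.
have w1b : w1 ^ b = w1 ^ x.
  rewrite /w1 !(conjMg (x ^- 2)) x2V_b (conjJg _ a b) (yk_b 2%N) ab.
  by rewrite (conjgM _ a x) (conj_commute (xV2 1%N)).
have w2b : w2 ^ b = w2 ^ (x ^+ 2).
  have a2b : (a ^+ 2) ^ b = a ^+ 2 * x ^+ 2.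
    by rewrite conjXg ab expgMn //; apply: commute_sym.
  rewrite /w2 !(conjMg (x ^- 2)) x2V_b (conjJg _ (a ^+ 2) b) (yk_b 1%N) a2b.
  by rewrite (conjgM _ (a ^+ 2)) (conj_commute (xV2 2%N)).
have yw k : (y ^+ k * (x ^- 2) ^ c) ^ b = (y ^+ k * (x ^- 2) ^ c) ^ y^-1.
  rewrite !(conjMg (y ^+ k)) yk_b (conjJg _ c b) x2V_b cb (conjgM _ c).
  congr (_ * _); apply/esym/conj_commute/commuteV/commute_sym/commuteX.
  exact: commute_refl.
have [c11 c12 c13] := conj_transfer xb yb w1b (eq_trans (congr1 (conjg^~ b) w1E)
  (eq_trans (yw 2%N) (esym (congr1 (conjg^~ y^-1) w1E)))).
have x2b : commute (x ^+ 2) b by apply/commute_sym/commuteX/commute_sym.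
have [c21 _ c23] := conj_transfer x2b yb w2b (eq_trans (congr1 (conjg^~ b) w2E)
  (eq_trans (yw 1%N) (esym (congr1 (conjg^~ y^-1) w2E)))).
pose k := x ^+ 2 * y * x ^- 2 * y^-1.
have kw2 : commute w2 k.
  suff -> : k = (x ^+ 2 * y) * ((x ^+ 2)^-1 * y^-1) by apply: commuteM.
  by rewrite /k !mulgA.
have kw1 : commute w1 k.
  suff -> : k = (x ^+ 2 * y ^+ 2) * (x * y)^-1 * (x^-1 * y^-1).
    by do !apply: commuteM => //; apply: commuteV.
  by rewrite /k !expg2 !gnorm.
have yE : y = w1 * w2^-1 by rewrite w1E w2E expg2 !gnorm.
have yk : commute k y.
  rewrite yE; apply: commuteM; first exact: commute_sym.
  exact/commuteV/commute_sym.
have k1 : k = 1.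
  apply: f_tf.
    have ker z : commute (f z) (f y) -> f (z * y * z^-1 * y^-1) = 1.
      by move=> fzy; rewrite !(gmulfM, gmulfV) fzy mulgK divgg.
    by apply: ker; rewrite gmulfXn; apply/commute_sym/commuteX/commute_sym.
  have kyE : k * y = y ^ (x ^- 2).
    by rewrite /k /conjg !gnorm.
  have : (k * y) ^+ p = 1 by rewrite kyE -conjXg yp conj1g.
  by rewrite expgMn // yp mulg1.
have x2y : commute (x ^+ 2) y.
  by move/divg1_eq/eqP: k1; rewrite divg_eq => /eqP.
have -> : x = (x ^+ 2) ^+ (p./2).+1.
  rewrite -expgnA mulnS mul2n.
  have -> : (2 + p./2.*2 = p.+1)%N.
    by rewrite -{2}(odd_double_half p) p_odd.
  by rewrite expgS xp mulg1.
by apply/commute_sym/commuteX/commute_sym.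
Qed.

End TorsionFreeKernel.

(** * Steinberg relations between monomials *)

(** Disequalities between indices only slow [lia] down. *)
Ltac natlia :=
  repeat match goal with h : is_true (_ != _) |- _ => clear h end; lia.

Ltac neq := solve [done | rewrite eq_sym; done].

Lemma avoid_three (I : finType) : 3 < #|I| ->
  forall a b c : I, exists d, [/\ d != a, d != b & d != c].
Proof.
move=> I4 a b c; case: (pickP [pred d | [&& d != a, d != b & d != c]]) => [d|nd].
  by case/and3P; exists d.
move: I4; rewrite ltnNge -cardsT => /negP[].
apply: leq_trans (card_size [:: a; b; c]); apply: subset_leq_card.
apply/fintype.subsetP => x _; have /= := nd x.
by rewrite !inE; do 3!case: eqP => //=.
Qed.

Section Truncated.
Local Open Scope group_scope.
Variables (G H : groupType) (f : UMagmaMorphism.type G H) (p : nat).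
Variable I : finType.
Variable y : I -> I -> nat -> G.

(** [y a b i] stands for the elementary matrix with entry [t ^ i] at [(a, b)];
    the relations are required as far as all the monomials which occur in them
    have degree at most [d]. *)
Record steinberg_upto (d : nat) : Prop := SteinbergUpto {
  st_exp : forall a b i, a != b -> (i <= d)%N -> y a b i ^+ p = 1;
  st_mul : forall a b c i j, a != b -> b != c -> a != c -> (i + j <= d)%N ->
    [~ y a b i, y b c j] = y a c (i + j);
  st_com : forall a b c e i j, a != b -> c != e -> b != c -> a != e ->
    (i <= d)%N -> (j <= d)%N -> commute (y a b i) (y c e j) }.

Hypothesis f_tf : kernel_has_no_torsion f p.
Hypothesis I4 : 3 < #|I|.
Hypothesis p_odd : odd p.
Hypothesis f_com : forall a b c e i j, a != b -> c != e -> b != c -> a != e ->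
  commute (f (y a b i)) (f (y c e j)).

Section Step.
Variable d : nat.
Hypothesis d2 : 1 < d.
Hypothesis yd : steinberg_upto d.
Hypothesis y_next : forall a c, a != c -> exists b,
  [/\ a != b, b != c & y a c d.+1 = [~ y a b d, y b c 1]].

(** Along the chain [a], [e], [b], [c] the entry [(a, c)] is reached through [b]
    or through [e], with [u] degrees passing from one factor to the other. *)
Lemma chain_shift a e b c i u j : a != e -> a != b -> a != c ->
  e != b -> e != c -> b != c -> (i + u <= d)%N -> (u + j <= d)%N ->
  [~ y a b (i + u), y b c j] = [~ y a e i, y e c (u + j)] /\
  commute (y a b (i + u)) [~ y a b (i + u), y b c j].
Proof.
move=> ae ab ac eb ec bc iu uj.
have P : [~ y a e i, y e b u] = y a b (i + u) by apply: (st_mul yd); neq.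
have Q : [~ y e b u, y b c j] = y e c (u + j) by apply: (st_mul yd); neq.
rewrite -P -Q; apply: shift_commutator; rewrite ?P ?Q;
  by apply: (st_com yd) => //; try neq; natlia.
Qed.

(** [chain_shift] changes the middle index, and moves one degree at a time from
    the left factor to the right one; so every commutator of total degree
    [d.+1] agrees with the one which defines [y a c d.+1]. *)
Lemma next_mul a b c i j : a != b -> b != c -> a != c ->
  (0 < i)%N -> (0 < j)%N -> (i + j = d.+1)%N ->
  [~ y a b i, y b c j] = y a c d.+1.
Proof.
move=> + + ac; elim: j i b => // j IH i b ab bc i0 _ ij.
case: j => [|j] in IH ij *.
  have {ij i0} -> : i = d by natlia.
  have [e [ae ec ->]] := y_next ac.
  have [-> //|be] := eqVneq b e.
  case: (@chain_shift a e b c d 0 1); try neq; try natlia.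
  by rewrite addn0 add0n.
have [e [ea eb ec]] := avoid_three I4 a b c.
case: (@chain_shift a b e c i 1 j.+1); try neq; try natlia.
rewrite add1n => <- _.
by apply: IH; neq || natlia.
Qed.

(** By [chain_shift] the commutator commutes with its left factor, from which it
    inherits the exponent. *)
Lemma next_exp a c : a != c -> y a c d.+1 ^+ p = 1.
Proof.
move=> ac; have [b [ba bc _]] := avoid_three I4 a c c.
have [e [ea eb ec]] := avoid_three I4 a b c.
rewrite -(@next_mul a b c d 1) //; [|neq|natlia|natlia].
case: (@chain_shift a e b c d 0 1); try neq; try natlia.
rewrite addn0 => _ dR; rewrite -commXg //.
by rewrite (st_exp yd) ?comm1g //; neq.
Qed.

(** Three indices leave room for a middle index off all of them; both factors of
    the commutator then commute with [y e g m]. *)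
Lemma next_com_shared a c e g m : a != c -> e != g -> c != e -> a != g ->
  (a == e) || (c == g) -> (m <= d)%N -> commute (y a c d.+1) (y e g m).
Proof.
move=> ac eg ce ag aecg md.
have [b [ba bc be bg]] : exists b, [/\ b != a, b != c, b != e & b != g].
  case/orP: aecg => /eqP <-.
    by have [b []] := avoid_three I4 a c g; exists b.
  by have [b []] := avoid_three I4 a c e; exists b.
rewrite -(@next_mul a b c d 1) //; [|neq|natlia|natlia].
apply/commute_sym/commuteR; apply: (st_com yd) => //; try neq; natlia.
Qed.

(** Four distinct indices may leave no room for a fifth.  If [m] is positive,
    both elements are commutators with the factor [y e c 1], so that
    [neighbour_commutators_commute] applies.  If [m] is 0, conjugation by
    [y e g 0] moves the factor [y g c 1] by an element of degree 1 only, which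
    is harmless. *)
Lemma next_com a c e g m : a != c -> e != g -> c != e -> a != g ->
  (m <= d)%N -> commute (y a c d.+1) (y e g m).
Proof.
move=> ac eg ce ag md.
have [|] := boolP ((a == e) || (c == g)); first by move/next_com_shared; apply.
rewrite negb_or => /andP[ae cg]; case: m md => [|m] md.
  pose u := y e g 0; pose A := y a g d; pose B := y g c 1.
  have ugB : [~ u, B] = y e c 1 by apply: (st_mul yd); neq || natlia.
  rewrite -(@next_mul a g c d 1) //; try neq; try natlia.
  apply: commute_conj; rewrite conjRg -/A -/B -/u.
  rewrite conj_commute; last by apply: (st_com yd); neq || natlia.
  rewrite (commgMR B u) -(invgR u B) ugB commgM.
  have -> : [~ A, (y e c 1)^-1] = 1.
    by apply/eqP/commgP/commuteV; apply: (st_com yd); neq || natlia.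
  rewrite mul1g conj_commute // (@next_mul a g c d 1); try neq; try natlia.
  by apply: commuteV; apply: next_com_shared; rewrite ?eqxx ?orbT; neq || natlia.
have yE : y e g m.+1 = [~ y e c 1, y c g m].
  by rewrite (st_mul yd); neq || natlia.
have xE : y a c d.+1 = [~ y a e d, y e c 1].
  by rewrite (@next_mul a e c d 1) //; neq || natlia.
apply: (neighbour_commutators_commute f_tf xE yE) => //.
- by apply: (st_com yd); neq || natlia.
- by apply: next_com_shared; rewrite ?eqxx; neq || natlia.
- by apply: next_com_shared; rewrite ?eqxx ?orbT; neq || natlia.
- by apply: (st_com yd); neq || natlia.
- by apply: (st_com yd); neq || natlia.
- exact: next_exp.
- by apply: (st_exp yd); neq || natlia.
- by apply: f_com; neq.
Qed.

Lemma next_com_next a c e g : a != c -> e != g -> c != e -> a != g ->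
  commute (y a c d.+1) (y e g d.+1).
Proof.
move=> ac eg ce ag.
have [ae|ae] := eqVneq a e.
  have [cg|cg] := eqVneq c g; first by rewrite -ae -cg.
  have [b [ba bc bg]] := avoid_three I4 a c g.
  rewrite -(@next_mul e b g d 1) -?ae //; try neq; try natlia.
  by apply: commuteR; apply: next_com; neq || natlia.
have [cg|cg] := eqVneq c g.
  have [b [ba bc be]] := avoid_three I4 a c e.
  rewrite -(@next_mul e b g d 1) -?cg //; try neq; try natlia.
  by apply: commuteR; apply: next_com; neq || natlia.
have yE : y e g d.+1 = [~ y e c 1, y c g d].
  by rewrite (@next_mul e c g 1 d) //; neq || natlia.
have xE : y a c d.+1 = [~ y a e d, y e c 1].
  by rewrite (@next_mul a e c d 1) //; neq || natlia.
apply: (neighbour_commutators_commute f_tf xE yE) => //.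
- by apply: (st_com yd); neq || natlia.
- by apply: next_com; neq || natlia.
- by apply: next_com; neq || natlia.
- by apply: next_com; neq || natlia.
- by apply: next_com; neq || natlia.
- exact: next_exp.
- by apply: next_exp; neq.
- by apply: f_com; neq.
Qed.

Lemma steinberg_step : steinberg_upto d.+1.
Proof.
have com a b c e i j : a != b -> c != e -> b != c -> a != e ->
    (i <= d.+1)%N -> (j <= d.+1)%N -> commute (y a b i) (y c e j).
  move=> ab ce bc ae; rewrite (leq_eqVlt i) (leq_eqVlt j) !ltnS.
  case/predU1P => [->|id]; case/predU1P => [->|jd].
  - exact: next_com_next.
  - exact: next_com.
  - by apply: commute_sym; apply: next_com; neq.
  - exact: (st_com yd).
split=> // [a b i ab|a b c i j ab bc ac].
  rewrite leq_eqVlt ltnS => /predU1P[->|id]; first exact: next_exp.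
  exact: (st_exp yd).
rewrite leq_eqVlt ltnS => /predU1P[ij|]; last exact: (st_mul yd).
(* Products with a factor of degree 0 and one of degree [d.+1] are reached by a
   shift along a chain. *)
rewrite ij; case: (posnP i) => [i0|i0]; last first.
  case: (posnP j) => [j0|j0]; last exact: next_mul.
  have [e [ea eb ec]] := avoid_three I4 a b c.
  have iE : i = d.+1 by natlia.
  have P : [~ y a e d, y e b 1] = y a b d.+1 by apply: next_mul; neq || natlia.
  have Q : [~ y e b 1, y b c 0] = y e c 1 by apply: (st_mul yd); neq || natlia.
  have [| | |+ _] := @shift_commutator _ (y a e d) (y e b 1) (y b c 0).
  - by apply: com; neq || natlia.
  - by rewrite P; apply: com; neq || natlia.
  - by rewrite P Q; apply: com; neq || natlia.
  by rewrite P Q iE j0 => ->; apply: next_mul; neq || natlia.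
have [e [ea eb ec]] := avoid_three I4 a b c.
have jE : j = d.+1 by natlia.
have P : [~ y a b 0, y b e 1] = y a e 1 by apply: (st_mul yd); neq || natlia.
have Q : [~ y b e 1, y e c d] = y b c d.+1 by apply: next_mul; neq || natlia.
have [| | |+ _] := @shift_commutator _ (y a b 0) (y b e 1) (y e c d).
- by apply: com; neq || natlia.
- by rewrite P; apply: com; neq || natlia.
- by rewrite P Q; apply: com; neq || natlia.
by rewrite P Q i0 jE => <-; apply: next_mul; neq || natlia.
Qed.

End Step.

Lemma steinberg_all d0 : 1 < d0 -> steinberg_upto d0 ->
    (forall d a c, (d0 <= d)%N -> a != c -> exists b,
      [/\ a != b, b != c & y a c d.+1 = [~ y a b d, y b c 1]]) ->
  forall d, steinberg_upto d.
Proof.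
move=> d02 y0 y_next d.
have [dd0|] := leqP d0 d; last first.
  move=> /ltnW dd0; case: y0 => E M C.
  have le i : (i <= d)%N -> (i <= d0)%N by move/leq_trans; apply.
  by split=> *; [apply: E | apply: M | apply: C] => //; apply: le.
elim: d dd0 => [|d IH]; first by natlia.
rewrite leq_eqVlt => /predU1P[<- //|]; rewrite ltnS => dd0.
apply: steinberg_step; first by natlia.
- exact: IH.
- by move=> a c; apply: y_next.
Qed.

End Truncated.

(** * Elementary matrices and their lifts *)

Section ElementaryMatrices.
Local Open Scope ring_scope.
Variables (R : comNzRingType) (m : nat).
Implicit Types (a b c e : 'I_m) (r s : R).

Lemma elementary_mx_mul a b c e r s :
  elementary_mx a b r *m elementary_mx c e s =
  1%:M + r *: delta_mx a b + s *: delta_mx c e + (r * s) *: (delta_mx a e *+ (b == c)).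
Proof.
rewrite /elementary_mx mulmxDl mul1mx mulmxDr mulmx1 -scalemxAl -scalemxAr.
by rewrite mul_delta_mx_cond scalerA -!addrA; congr (_ + _); rewrite addrCA.
Qed.

Lemma elementary_mxD a b r s : a != b ->
  elementary_mx a b r *m elementary_mx a b s = elementary_mx a b (r + s).
Proof.
rewrite elementary_mx_mul eq_sym => /negPf ->.
by rewrite mulr0n scaler0 addr0 /elementary_mx scalerDl addrA.
Qed.

Lemma elementary_mxC a b c e r s : b != c -> a != e ->
  elementary_mx a b r *m elementary_mx c e s =
  elementary_mx c e s *m elementary_mx a b r.
Proof.
rewrite !elementary_mx_mul (eq_sym e) => /negPf -> /negPf ->.
by rewrite !mulr0n !scaler0 !addr0 addrAC.
Qed.

Lemma elementary_mxR a b c r s : a != b -> b != c -> a != c ->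
  elementary_mx a b r *m elementary_mx b c s =
  elementary_mx b c s *m elementary_mx a b r *m elementary_mx a c (r * s).
Proof.
move=> ab bc ac; rewrite -mulmxA elementary_mx_mul eqxx mulr1n.
rewrite (elementary_mx_mul a b a c) (eq_sym b) (negPf ab) mulr0n scaler0 addr0.
rewrite /elementary_mx mulmxDl mul1mx !mulmxDr mulmx1 -!scalemxAl -!scalemxAr.
rewrite !mul_delta_mx_cond (eq_sym c) (negPf ac) mulr0n !scaler0 !addr0.
by rewrite -!addrA; congr (_ + _); rewrite addrCA addrC -!addrA; congr (_ + _); rewrite addrC.
Qed.

Lemma elementary_mxX a b r k : a != b ->
  forall g : SL R m, SL_mx g = elementary_mx a b r ->
  SL_mx (g ^+ k)%g = elementary_mx a b (r *+ k).
Proof.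
move=> ab g gE; elim: k => [|k IH].
  by rewrite /elementary_mx mulr0n scale0r addr0.
by rewrite expgS /= IH gE elementary_mxD // mulrS.
Qed.

Lemma row_elementary (v : 'rV[R]_m) a b r j :
  (v *m elementary_mx a b r) 0 j = v 0 j + (v 0 a * r) *+ (j == b).
Proof.
rewrite /elementary_mx mulmxDr mulmx1 -scalemxAr !mxE (bigD1 a) //= !mxE eqxx /=.
rewrite big1 => [|i ia]; last by rewrite !mxE (negPf ia) mulr0.
by rewrite addr0; case: (j == b); rewrite ?mulr1 ?mulr0 ?mulr1n // mulrC.
Qed.

End ElementaryMatrices.

Section Lifts.
Local Open Scope ring_scope.
Variables (G : groupType) (p m : nat).
Local Notation R := {poly 'F_p}.
Variable f : UMagmaMorphism.type G (SL R m).
Variable x : 'I_m -> 'I_m -> R -> G.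

Record steinberg_lift : Prop := SteinbergLift {
  lift_add : forall a b r s, a != b -> x a b (r + s) = (x a b r * x a b s)%g;
  lift_mul : forall a b c r s, a != b -> b != c -> a != c ->
    [~ x a b r, x b c s]%g = x a c (r * s);
  lift_com : forall a b c e r s, a != b -> c != e -> b != c -> a != e ->
    commute (x a b r) (x c e s);
  lift_mx : forall a b r, a != b -> SL_mx (f (x a b r)) = elementary_mx a b r }.

End Lifts.

Section PolynomialRootGroups.
Local Open Scope classical_set_scope.
Local Open Scope ring_scope.
Variables (G : groupType) (p m : nat).
Local Notation R := {poly 'F_p}.
Variable f : UMagmaMorphism.type G (SL R m).
Hypothesis f_tf : kernel_has_no_torsion f p.
Variable y : 'I_m -> 'I_m -> nat -> G.
Hypothesis y_st : forall d, steinberg_upto p y d.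
Hypothesis y_mx : forall a b i, a != b ->
  SL_mx (f (y a b i)) = elementary_mx a b 'X^i.

Let X a b : set G := Defs.generated (range (y a b)).

Let Xmin a b (S : set G) : subgroup S -> (forall i, S (y a b i)) ->
  forall u, X a b u -> S u.
Proof. by move=> gS yS; apply: generated_min => // u [i _ <-]. Qed.

Let Xy a b i : X a b (y a b i).
Proof. by apply: generated_gen; exists i. Qed.

Let X_com a b c e : a != b -> c != e -> b != c -> a != e ->
  forall u v, X a b u -> X c e v -> commute u v.
Proof.
move=> ab ce bc ae u v Xu; apply: (Xmin (subgroup_centralizer u)) => j.
apply: commute_sym.
apply: (Xmin (subgroup_centralizer (y c e j)) _ Xu) => i; apply: commute_sym.
by apply: (st_com (y_st (maxn i j))); rewrite // ?leq_maxl ?leq_maxr.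
Qed.

Let X_exp a b : a != b -> forall u, X a b u -> (u ^+ p = 1)%g.
Proof.
move=> ab u Xu.
suff: (X a b `&` [set v | v ^+ p = 1]%g) u by case.
apply: (Xmin (S := X a b `&` [set v | v ^+ p = 1]%g)) Xu => [|i]; last first.
  by split=> //; apply: (st_exp (y_st i)).
split=> [|v w [Xv vp] [Xw wp]|v [Xv vp]].
- by split; [exact: generated1 | exact: expg1n].
- split; first exact: generatedM.
  by rewrite /= expgMn ?vp ?wp ?mulg1 //; apply: X_com Xv Xw; neq.
- by split; [exact: generatedV | rewrite /= expVgn vp invg1].
Qed.

Let X_inj a b : a != b -> forall u v, X a b u -> X a b v -> f u = f v -> u = v.
Proof.
move=> ab u v Xu Xv; apply: (commuting_lifts_eq f_tf).
- by apply: X_com Xu Xv; neq.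
- exact: X_exp Xu.
- exact: X_exp Xv.
Qed.

Let X_R a b c : a != b -> b != c -> a != c ->
  forall u v, X a b u -> X b c v -> X a c [~ u, v]%g.
Proof.
move=> ab bc ac u v Xu Xv.
have com_ab w z : X a b w -> X a c z -> commute w z by apply: X_com; neq.
have com_bc w z : X b c w -> X a c z -> commute w z by apply: X_com; neq.
pose S w := X a b w /\ forall v, X b c v -> X a c [~ w, v]%g.
suff: S u by case=> _; apply.
move: u Xu {v Xv}; apply: Xmin => [|i].
  split=> [|w z [Xw Sw] [Xz Sz]|w [Xw Sw]].
  - by split=> [|v _]; rewrite ?comm1g; exact: generated1.
  - split=> [|v Xv]; first exact: generatedM.
    rewrite commMg conj_commute; first exact: generatedM (Sw _ Xv) (Sz _ Xv).
    by apply/commute_sym/com_ab => //; apply: Sw.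
  - split=> [|v Xv]; first exact: generatedV.
    rewrite commVg conj_commute; first exact: generatedV (Sw _ Xv).
    by apply/commute_sym/com_ab; [exact: generatedV|exact: generatedV (Sw _ Xv)].
split=> // v Xv.
suff: (X b c `&` [set v | X a c [~ y a b i, v]%g]) v by case.
apply: Xmin Xv => [|j].
  split=> [|w z [Xw Sw] [Xz Sz]|w [Xw Sw]].
  - by split; rewrite /= ?commg1; exact: generated1.
  - split; first exact: generatedM.
    rewrite /= commgM conj_commute; first exact: generatedM Sz Sw.
    by apply/commute_sym/com_bc.
  - split; first exact: generatedV.
    rewrite /= commgV conj_commute; first exact: generatedV.
    by apply/commute_sym/com_bc; exact: generatedV.
split=> //=; rewrite (st_mul (y_st (i + j))) //; exact: Xy.
Qed.

Let X_lift a b r : a != b -> exists u, X a b u /\ SL_mx (f u) = elementary_mx a b r.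
Proof.
move=> ab.
rewrite -[r]coefK poly_def.
apply: (big_ind (fun s => exists u, X a b u /\ SL_mx (f u) = elementary_mx a b s)).
- exists 1%g; split; first exact: generated1.
  by rewrite gmulf1 /elementary_mx scale0r addr0.
- move=> s t [u [Xu uE]] [v [Xv vE]]; exists (u * v)%g.
  split; first exact: generatedM.
  by rewrite gmulfM /= uE vE elementary_mxD.
- move=> i _; pose k : nat := (nth 0%R (polyseq r) i : 'F_p); exists (y a b i ^+ k)%g.
  split; first by apply: generatedX; exact: Xy.
  rewrite gmulfXn (elementary_mxX _ ab (y_mx i ab)) -scaler_nat.
  by rewrite natr_Zp.
Qed.

Let x a b r := xget 1%g [set u | X a b u /\ SL_mx (f u) = elementary_mx a b r].

Let xP a b r : a != b -> X a b (x a b r) /\ SL_mx (f (x a b r)) = elementary_mx a b r.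
Proof.
move=> ab; rewrite /x; case: xgetP => [u _ //|nx].
by have [u] := X_lift r ab => /nx.
Qed.

Let x_uniq a b r u : a != b -> X a b u -> SL_mx (f u) = elementary_mx a b r ->
  u = x a b r.
Proof.
move=> ab Xu uE; have [Xx xE] := xP r ab.
by apply: (X_inj ab Xu Xx); apply: val_inj; rewrite /= uE xE.
Qed.

(** The elements [y a b i], for fixed [a] and [b], generate an abelian group of
    exponent [p], on which [f] is injective because its kernel has no
    [p]-torsion.  A polynomial therefore has exactly one lift in this group, and
    every relation follows from uniqueness. *)
Lemma steinberg_lift_of_monomials : exists x : 'I_m -> 'I_m -> R -> G,
  steinberg_lift f x /\ forall a b i, a != b -> x a b 'X^i = y a b i.
Proof.
exists x; split; last by move=> a b i ab; apply/esym/x_uniq => //; exact: y_mx.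
split=> [a b r s ab|a b c r s ab bc ac|a b c e r s ab ce bc ae|a b r ab].
- have [Xr rE] := xP r ab; have [Xs sE] := xP s ab.
  apply/esym/x_uniq => //; first exact: generatedM.
  by rewrite gmulfM /= rE sE elementary_mxD.
- have [Xr rE] := xP r ab; have [Xs sE] := xP s bc.
  apply: x_uniq => //; first exact: X_R Xr Xs.
  have [_ tE] := xP (r * s) ac; rewrite -tE; congr SL_mx.
  apply: (@mulgI _ (f (x b c s) * f (x a b r))%g); apply: val_inj.
  rewrite gmulfR -commgC /= rE sE tE; exact: elementary_mxR.
- by apply: X_com (xP r ab).1 (xP s ce).1.
- exact: (xP r ab).2.
Qed.

End PolynomialRootGroups.

(** * Symbols over a prime field *)

Section SymbolsOverPrimeField.
Local Open Scope ring_scope.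
Variables (G : groupType) (p : nat) (c : 'F_p -> 'F_p -> G).
Hypothesis p_pr : prime p.
Hypothesis cMl : forall u v w : 'F_p, u != 0 -> v != 0 -> w != 0 ->
  c (u * v) w = (c u w * c v w)%g.
Hypothesis cMr : forall u v w : 'F_p, u != 0 -> v != 0 -> w != 0 ->
  c u (v * w) = (c u v * c u w)%g.
Hypothesis c_skew : forall u v : 'F_p, u != 0 -> v != 0 -> (c u v * c v u)%g = 1%g.
Hypothesis c_steinberg : forall u v : 'F_p, u != 0 -> v != 0 -> u + v = 1 ->
  c u v = 1%g.

Lemma prime_field_generator : exists2 z : 'F_p, z != 0 &
  forall u, u != 0 -> exists i, u = z ^+ i.
Proof.
have /cyclicP[g gE] := field_unit_group_cyclic [set: {unit 'F_p}]%G.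
exists (FinRing.uval g); first by rewrite -unitfE; apply: (valP g).
move=> u; rewrite -unitfE => uU.
have : FinRing.Unit uU \in <[g]>%g by rewrite -gE inE.
case/cycleP => i /(congr1 val) /=; rewrite FinRing.val_unitX => ->.
by exists i.
Qed.

Lemma symbol1l u : u != 0 -> c 1 u = 1%g.
Proof.
move=> u0; have := @cMl 1 1 u (oner_neq0 _) (oner_neq0 _) u0.
by rewrite mulr1 -{1}[c _ _]mulg1 => /mulgI.
Qed.

Lemma symbol1r u : u != 0 -> c u 1 = 1%g.
Proof.
move=> u0; have := @cMr u 1 1 u0 (oner_neq0 _) (oner_neq0 _).
by rewrite mulr1 -{1}[c _ _]mulg1 => /mulgI.
Qed.

Lemma symbolX z i j : z != 0 -> c (z ^+ i) (z ^+ j) = (c z z ^+ (i * j))%g.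
Proof.
move=> z0; elim: i => [|i IH].
  by rewrite expr0 mul0n symbol1l // expf_neq0.
rewrite exprS cMl ?expf_neq0 // IH mulSn expgnDr; congr (_ * _)%g.
elim: j {IH} => [|j IH]; first by rewrite expr0 symbol1r.
by rewrite exprS cMr ?expf_neq0 // IH expgS.
Qed.

(** [- u] is the quotient of [1 - u] by [1 - u^-1]. *)
Lemma symbolN u : u != 0 -> c u (- u) = 1%g.
Proof.
move=> u0; have [->|u1] := eqVneq u 1.
  by rewrite symbol1l // oppr_eq0 oner_eq0.
have v0 : u^-1 != 0 by rewrite invr_eq0.
have t0 : 1 - u != 0 by rewrite subr_eq0 eq_sym.
have s0 : 1 - u^-1 != 0 by rewrite subr_eq0 eq_sym invr_eq1.
have : c u (1 - u^-1) = 1%g.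
  have := @cMl u u^-1 (1 - u^-1) u0 v0 s0.
  rewrite divff // symbol1l // (@c_steinberg u^-1) //; last by ring.
  by rewrite mulg1.
have : c u (- u * (1 - u^-1)) = 1%g.
  apply: c_steinberg => //; first by rewrite mulf_neq0 // oppr_eq0.
  by rewrite mulrBr mulr1 mulNr divff //; ring.
by rewrite cMr ?oppr_eq0 // => + E; rewrite E mulg1.
Qed.

(** On the cyclic group of units every symbol is a power of [c z z], whose square
    is trivial.  Let [k] run up from 1.  If every [c t k] is trivial, then
    [c (k + 1) (- k) = 1] gives [c (k + 1) (- 1) = 1] and then
    [c (k + 1) (k + 1) = 1].  If [k + 1] is an odd power of [z], this last
    symbol is [c z z]; if it is an even power, every [c t (k + 1)] is trivial
    and [k] goes up.  It ends at [z] itself at the latest. *)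
Lemma symbol_trivial u v : u != 0 -> v != 0 -> c u v = 1%g.
Proof.
have [z z0 zP] := prime_field_generator.
have c02 : (c z z ^+ 2)%g = 1%g by exact: c_skew.
have nz k : (0 < k < p)%N -> (k%:R : 'F_p) != 0.
  case/andP => k0 kp; rewrite -(dvdn_pcharf (pchar_Fp p_pr)).
  by apply: contraTN kp => /(dvdn_leq k0); rewrite -leqNgt.
have step k : (0 < k < p)%N ->
    c z z = 1%g \/ forall t, t != 0 -> c t k%:R = 1%g.
  case: k => // k; elim: k => [_|k IH kp].
    by right=> t t0; apply: symbol1r.
  have kp' : (0 < k.+1 < p)%N by apply/andP; split => //; case/andP: kp => _ /ltnW.
  case: (IH kp') => [|ck]; [by left|].
  have k0 := nz _ kp; have k0' := nz _ kp'.
  have n1 : (-1 : 'F_p) != 0 by rewrite oppr_eq0 oner_eq0.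
  have cN1 : c k.+2%:R (-1) = 1%g.
    have : c k.+2%:R (- 1 * k.+1%:R) = 1%g.
      apply: c_steinberg => //; first by rewrite mulf_neq0.
      by rewrite mulN1r -[k.+2]add1n natrD addrK.
    by rewrite cMr // ck // mulg1.
  have [i iE] := zP _ k0.
  have : c k.+2%:R k.+2%:R = 1%g.
    by have := symbolN k0; rewrite -mulN1r cMr // cN1 mul1g.
  rewrite {1 2}iE symbolX // => cii.
  have [i_odd|i_even] := boolP (odd i).
    left; rewrite -cii -(odd_double_half (i * i)) oddM i_odd expgnDr -mul2n.
    by rewrite expgnA c02 expg1n mulg1.
  right=> t /zP[j ->]; rewrite iE symbolX //.
  have iE2 : i = (2 * i./2)%N by rewrite mul2n -[LHS]odd_double_half (negPf i_even).
  by rewrite iE2 mulnCA expgnA c02 expg1n.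
have c0 : c z z = 1%g.
  have zp : (0 < (z : nat) < p)%N.
    rewrite lt0n; apply/andP; split; last by rewrite -{2}(Fp_cast p_pr) ltn_ord.
    by apply: contraNN z0 => /eqP zz; rewrite -[z]natr_Zp zz.
  case: (step _ zp) => // E; rewrite -{2}[z]natr_Zp; exact: E.
by move=> /zP[i ->] /zP[j ->]; rewrite symbolX // c0 expg1n.
Qed.

End SymbolsOverPrimeField.

(** * Lifts of monomial matrices *)

Section MonomialElements.
Local Open Scope ring_scope.
Variables (G : groupType) (p m : nat).
Hypotheses (p_pr : prime p) (m4 : (3 < #|'I_m|)%N).
Local Notation R := {poly 'F_p}.
Variable f : UMagmaMorphism.type G (SL R m).
Variable x : 'I_m -> 'I_m -> R -> G.
Hypothesis x_lift : steinberg_lift f x.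
Implicit Types (a b c e : 'I_m) (r s : R) (u v t : 'F_p).

Let xD := lift_add x_lift.
Let xM := lift_mul x_lift.
Let xC := lift_com x_lift.

Lemma lift0 a b : a != b -> x a b 0 = 1%g.
Proof.
move=> ab; have := xD 0 0 ab.
by rewrite addr0 -{1}[x a b 0]mulg1 => /mulgI.
Qed.

Lemma liftN a b r : a != b -> x a b (- r) = (x a b r)^-1%g.
Proof.
by move=> ab; apply/esym/mulg1_eq; rewrite -xD // subrr lift0.
Qed.

Lemma conj_before a b c r s : a != b -> b != c -> a != c ->
  (x a c r ^ x b a s)%g = (x a c r * x b c (- (s * r)))%g.
Proof.
by move=> ab bc ac; rewrite commgMR -invgR xM ?liftN //; neq.
Qed.

Lemma conj_after a b c r s : a != b -> b != c -> a != c ->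
  (x c a r ^ x a b s)%g = (x c a r * x c b (r * s))%g.
Proof. by move=> ab bc ac; rewrite commgMR xM //; neq. Qed.

Lemma conj_com a b c e r s : a != b -> c != e -> b != c -> a != e ->
  (x a b r ^ x c e s)%g = x a b r.
Proof. by move=> *; apply/conj_commute/xC. Qed.

(** Locked, lest rewriting with associativity see through it. *)
Definition weyl a b u :=
  locked (x a b u%:P * x b a (- u^-1)%:P * x a b u%:P)%g.

Definition diag a b u := locked (weyl a b u * weyl a b (-1)%R)%g.

Lemma weylE a b u :
  weyl a b u = (x a b u%:P * x b a (- u^-1)%:P * x a b u%:P)%g.
Proof. by rewrite /weyl -lock. Qed.

Lemma diagE a b u : diag a b u = (weyl a b u * weyl a b (-1)%R)%g.
Proof. by rewrite /diag -lock. Qed.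

Arguments weyl a b u%_R.
Arguments diag a b u%_R.

(** [g] acts on the root elements as the monomial matrix with entry [rho c] at
    [(c, s c)]. *)
Definition acts_as g (s : 'I_m -> 'I_m) (rho : 'I_m -> 'F_p) :=
  forall c e r, c != e ->
    (x c e r ^ g)%g = x (s c) (s e) (((rho c)^-1 * rho e)%:P * r).

Definition weyl_entry a b u c :=
  if c == a then u else if c == b then - u^-1 else 1.

Definition diag_entry a b u c :=
  if c == a then u else if c == b then u^-1 else 1.

Section WeylAction.
Variables (a b : 'I_m) (u : 'F_p).
Hypotheses (ab : a != b) (u0 : u != 0).

Let UV r : u%:P * (u^-1%:P * r) = r.
Proof. by rewrite mulrA -polyCM mulfV // mul1r. Qed.

Let VU r : u^-1%:P * (u%:P * r) = r.
Proof. by rewrite mulrA -polyCM mulVf // mul1r. Qed.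

(* The four ways in which an outside index [c] can meet [a] or [b]; the entries
   [(a, b)] and [(b, a)] are then commutators of these. *)
Let w_ac c r : c != a -> c != b ->
  (x a c r ^ weyl a b u)%g = x b c (u^-1%:P * r).
Proof.
move=> ca cb.
have E1 q : (x a c q ^ x a b u%:P)%g = x a c q by rewrite conj_com //; neq.
have E2 : (x a c r ^ x b a (- u^-1)%:P)%g = (x a c r * x b c (u^-1%:P * r))%g.
  by rewrite conj_before; try neq; rewrite polyCN mulNr opprK.
have E3 : (x b c (u^-1%:P * r) ^ x a b u%:P)%g
    = (x a c (- r) * x b c (u^-1%:P * r))%g.
  by rewrite conj_before; try neq; rewrite UV; apply: xC; neq.
rewrite weylE !conjgM E1 E2 conjMg E1 E3 mulgA -xD ?subrr ?lift0 ?mul1g //; neq.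
Qed.

Let w_bc c r : c != a -> c != b ->
  (x b c r ^ weyl a b u)%g = x a c (- (u%:P * r)).
Proof.
move=> ca cb.
have E1 q : (x a c q ^ x a b u%:P)%g = x a c q by rewrite conj_com //; neq.
have E2 : (x b c r ^ x a b u%:P)%g = (x b c r * x a c (- (u%:P * r)))%g.
  by rewrite conj_before; neq.
have E3 : (x a c (- (u%:P * r)) ^ x b a (- u^-1)%:P)%g
    = (x b c (- r) * x a c (- (u%:P * r)))%g.
  rewrite conj_before; try neq; rewrite polyCN mulNr mulrN opprK VU.
  by apply: xC; neq.
have E4 : (x b c r ^ x b a (- u^-1)%:P)%g = x b c r by rewrite conj_com //; neq.
by rewrite weylE !conjgM E2 conjMg E3 E4 mulgA -xD ?subrr ?lift0 ?mul1g ?E1 //; neq.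
Qed.

Let w_ca c r : c != a -> c != b ->
  (x c a r ^ weyl a b u)%g = x c b (u%:P * r).
Proof.
move=> ca cb.
have E1 q : (x c b q ^ x a b u%:P)%g = x c b q by rewrite conj_com //; neq.
have E2 : (x c a r ^ x a b u%:P)%g = (x c a r * x c b (u%:P * r))%g.
  by rewrite conj_after; try neq; rewrite [r * _]mulrC.
have E3 : (x c b (u%:P * r) ^ x b a (- u^-1)%:P)%g
    = (x c a (- r) * x c b (u%:P * r))%g.
  rewrite conj_after; try neq; rewrite polyCN mulrN [_ * u^-1%:P]mulrC VU.
  by apply: xC; neq.
have E4 : (x c a r ^ x b a (- u^-1)%:P)%g = x c a r by rewrite conj_com //; neq.
by rewrite weylE !conjgM E2 conjMg E3 E4 mulgA -xD ?subrr ?lift0 ?mul1g ?E1 //; neq.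
Qed.

Let w_cb c r : c != a -> c != b ->
  (x c b r ^ weyl a b u)%g = x c a (- (u^-1%:P * r)).
Proof.
move=> ca cb.
have E1 q : (x c b q ^ x a b u%:P)%g = x c b q by rewrite conj_com //; neq.
have E2 : (x c b r ^ x b a (- u^-1)%:P)%g
    = (x c b r * x c a (- (u^-1%:P * r)))%g.
  by rewrite conj_after; try neq; rewrite polyCN mulrN [_ * u^-1%:P]mulrC.
have E3 : (x c a (- (u^-1%:P * r)) ^ x a b u%:P)%g
    = (x c b (- r) * x c a (- (u^-1%:P * r)))%g.
  by rewrite conj_after; try neq; rewrite mulNr [_ * u%:P]mulrC UV; apply: xC; neq.
rewrite weylE !conjgM E1 E2 conjMg E1 E3 mulgA -xD ?subrr ?lift0 ?mul1g //; neq.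
Qed.

Lemma weyl_acts : acts_as (weyl a b u) (tperm a b) (weyl_entry a b u).
Proof.
move=> c e r ce; rewrite /weyl_entry.
have [d [da db _]] := avoid_three m4 a b a.
have [ca|ca] := eqVneq c a.
  rewrite {}ca in ce *; rewrite (eq_sym e) (negPf ce) tpermL.
  have [eb|eb] := eqVneq e b; last first.
    by rewrite tpermD ?mulr1 ?w_ac //; neq.
  rewrite eb tpermR -{1}[r]mulr1 -(@xM a d b); try neq.
  rewrite conjRg w_ac // w_cb // xM; try neq.
  by congr (x _ _ _); rewrite mulr1 polyCM polyCN; ring.
have [cb|cb] := eqVneq c b.
  rewrite {}cb in ce *; rewrite tpermR (eq_sym e b) (negPf ce).
  have [ea|ea] := eqVneq e a; last first.
    rewrite tpermD ?mulr1 ?w_bc //; try neq.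
    by congr (x _ _ _); rewrite invrN invrK polyCN; ring.
  rewrite ea tpermL -{1}[r]mulr1 -(@xM b d a); try neq.
  rewrite conjRg w_bc // w_ca // xM; try neq.
  by congr (x _ _ _); rewrite invrN invrK mulr1 polyCM polyCN; ring.
rewrite tpermD ?invr1 ?mul1r; try neq.
have [ea|ea] := eqVneq e a; first by rewrite ea tpermL w_ca //; neq.
have [eb|eb] := eqVneq e b.
  by rewrite eb tpermR w_cb; try neq; congr (x _ _ _); rewrite polyCN; ring.
rewrite tpermD ?mul1r; try neq.
by rewrite weylE !conjgM !conj_com //; neq.
Qed.

End WeylAction.

Lemma weylV a b u : a != b -> (weyl a b u)^-1%g = weyl a b (- u).
Proof.
move=> ab; rewrite !weylE !invgM -!liftN //; last by neq.
by rewrite !invrN !polyCN !opprK mulgA.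
Qed.

Lemma weyl_conj g (s : {perm 'I_m}) rho a b u : acts_as g s rho ->
    (forall c, rho c != 0) -> a != b -> u != 0 ->
  (weyl a b u ^ g)%g = weyl (s a) (s b) ((rho a)^-1 * rho b * u).
Proof.
move=> gs rho0 ab u0; rewrite !weylE !conjMg !gs //; last by neq.
by rewrite !polyCM; congr (_ * x _ _ _ * _)%g;
  rewrite -!polyCM; congr _%:P; field; rewrite ?rho0 u0.
Qed.

Lemma weyl_entry_neq0 a b u c : u != 0 -> weyl_entry a b u c != 0.
Proof.
move=> u0; rewrite /weyl_entry; case: ifP => // _.
by case: ifP; rewrite ?oppr_eq0 ?invr_eq0 ?oner_eq0.
Qed.

Lemma diag_entry_neq0 a b u c : u != 0 -> diag_entry a b u c != 0.
Proof.
move=> u0; rewrite /diag_entry; case: ifP => // _.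
by case: ifP; rewrite ?invr_eq0 ?oner_eq0.
Qed.

Let n1 : (-1 : 'F_p) != 0.
Proof. by rewrite oppr_eq0 oner_eq0. Qed.

Lemma acts_asM g h (s t : {perm 'I_m}) rho rho' : acts_as g s rho -> acts_as h t rho' ->
  acts_as (g * h)%g (s * t)%g (fun c => rho c * rho' (s c)).
Proof.
move=> gs ht c e r ce; rewrite conjgM gs // ht ?permM; last first.
  by apply: contra ce => /eqP/perm_inj ->.
by congr (x _ _ _); rewrite mulrA -polyCM; congr (_%:P * _); rewrite invfM; ring.
Qed.

Lemma acts_as_ext g (s t : {perm 'I_m}) rho rho' : s =1 t -> rho =1 rho' ->
  acts_as g s rho -> acts_as g t rho'.
Proof. by move=> st rr gs c e r ce; rewrite -!st -!rr; apply: gs. Qed.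

Lemma diag_acts a b u : a != b -> u != 0 ->
  acts_as (diag a b u) (1%g : {perm 'I_m}) (diag_entry a b u).
Proof.
move=> ab u0; rewrite diagE; have := acts_asM (weyl_acts ab u0) (weyl_acts ab n1).
apply: acts_as_ext => c; first by rewrite tperm2.
rewrite /weyl_entry /diag_entry invrN invr1 opprK.
case: (eqVneq c a) => [->|ca]; first by rewrite tpermL eq_sym (negPf ab) eqxx mulr1.
case: (eqVneq c b) => [->|cb]; first by rewrite tpermR eqxx mulrN1 opprK.
by rewrite tpermD ?(negPf ca) ?(negPf cb) ?mulr1 //; neq.
Qed.

Lemma weyl_swap a b u : a != b -> u != 0 -> weyl a b u = weyl b a (- u^-1).
Proof.
move=> ab u0; rewrite -{1}[weyl a b u](mulKg (weyl a b u)) -conjgE.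
rewrite (weyl_conj (weyl_acts ab u0)) //; last by move=> c; apply: weyl_entry_neq0.
rewrite tpermL tpermR /weyl_entry eqxx eq_sym (negPf ab) eqxx.
by congr weyl; field.
Qed.

Lemma diag1 a b : a != b -> diag a b 1 = 1%g.
Proof. by move=> ab; rewrite !diagE -weylV // mulgV. Qed.

Lemma weyl_diag a b u : a != b -> weyl a b u = (diag a b u * weyl a b 1%R)%g.
Proof. by move=> ab; rewrite !diagE -weylV // mulgVK. Qed.

Lemma diag_conj g (s : {perm 'I_m}) rho a b u : acts_as g s rho ->
    (forall c, rho c != 0) -> a != b -> u != 0 ->
  (diag a b u ^ g)%g = (diag (s a) (s b) ((rho a)^-1 * rho b * u) *
    (diag (s a) (s b) ((rho a)^-1 * rho b))^-1)%g.
Proof.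
move=> gs rho0 ab u0; have sab : s a != s b by apply: contra ab => /eqP/perm_inj ->.
rewrite !diagE conjMg !(weyl_conj gs) // mulgKA weylV //.
by rewrite mulrN1.
Qed.

Section Symbols.
Variables a b : 'I_m.
Hypothesis ab : a != b.
Local Notation h := (diag a b).
Local Notation w := (weyl a b).

(** The Steinberg symbol of [u] and [v]: what the torus lacks to be
    multiplicative. *)
Definition symbol u v := locked ((h u)^-1 * h (u * v)%R * (h v)^-1)%g.

Arguments symbol u%_R v%_R.

Lemma symbolE u v : symbol u v = ((h u)^-1 * h (u * v)%R * (h v)^-1)%g.
Proof. by rewrite /symbol -lock. Qed.

Let central (z : G) := forall c e r, c != e -> commute z (x c e r).

Let central_diag z c e u : central z -> c != e -> commute z (diag c e u).
Proof.
rewrite diagE !weylE.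
by move=> zc ce; apply: commuteM; do !apply: commuteM; apply: zc; neq.
Qed.
Let symbol_central u v : u != 0 -> v != 0 -> central (symbol u v).
Proof.
move=> u0 v0 c e r ce; rewrite symbolE; apply/commute_sym/commute_conj.
have uv0 : u * v != 0 by apply: mulf_neq0.
have diagV t : t != 0 -> acts_as (h t)^-1%g (1%g : {perm 'I_m})
    (fun c => (diag_entry a b t c)^-1).
  move=> t0 c' e' r' ce'; apply: (@conjg_inj _ (h t)).
  rewrite conjgKV !perm1 (diag_acts ab t0) // !perm1 mulrA -polyCM invrK.
  set d := diag_entry a b t.
  have -> : (d c')^-1 * d e' * (d c' * (d e')^-1) = 1.
    by field; rewrite !diag_entry_neq0.
  by rewrite mul1r.
have := acts_asM (acts_asM (diagV _ u0) (diag_acts ab uv0)) (diagV _ v0).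
move/(_ c e r ce); rewrite !permM !perm1 => ->.
have E c' : (diag_entry a b u c')^-1 * diag_entry a b (u * v) c' *
    (diag_entry a b v c')^-1 = 1.
  rewrite /diag_entry; case: ifP => _; first by field; rewrite u0 v0.
  by case: ifP => _; [field; rewrite u0 v0 | rewrite !invr1 !mulr1].
by rewrite !E invr1 mulr1 mul1r.
Qed.

Let diagM u v : u != 0 -> v != 0 -> h (u * v) = (symbol u v * (h u * h v))%g.
Proof.
move=> u0 v0; rewrite mulgA (central_diag _ (symbol_central u0 v0) ab).
by rewrite symbolE !mulgA mulgV mul1g mulgVK.
Qed.

(* A third index makes room for a torus [diag a c], which acts on [w u] by
   multiplying [u] by a scalar. *)
Let symbol_comm v : v != 0 -> exists2 k : G,
  forall u, u != 0 -> symbol u v = [~ h u, k]%g &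
  forall z, central z -> commute z k.
Proof.
move=> v0; have [c [ca cb _]] := avoid_three m4 a b a.
have ac : a != c by neq.
have v0' : v^-1 != 0 by rewrite invr_eq0.
exists (diag a c v^-1); last by move=> z zc; apply: central_diag.
move=> u u0; rewrite commgEl (diag_conj (diag_acts ac v0')) //; last first.
  by move=> e; apply: diag_entry_neq0.
rewrite !perm1 /diag_entry eqxx (eq_sym b a) (negPf ab) (eq_sym b c) (negPf cb).
by rewrite invrK mulr1 symbolE mulgA mulrC.
Qed.

Let central_symbol z u v : central z -> commute z (symbol u v).
Proof.
move=> zc; rewrite symbolE; have zh t : commute z (h t) by apply: central_diag.
by do !apply: commuteM => //; apply: commuteV.
Qed.

Let symbolMl u v t : u != 0 -> v != 0 -> t != 0 ->
  symbol (u * v) t = (symbol u t * symbol v t)%g.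
Proof.
move=> u0 v0 t0; have [k kE kC] := symbol_comm t0.
have zc := symbol_central u0 v0.
rewrite kE ?mulf_neq0 // diagM // commMg.
rewrite [X in (X ^ _)%g](_ : _ = 1%g); last exact/eqP/commgP/kC.
rewrite conj1g mul1g commMg -!kE // conj_commute //.
by apply: central_diag => //; apply: symbol_central.
Qed.

(* The associativity of [h] is a cocycle identity for [symbol]; with
   multiplicativity on the left it reduces to multiplicativity on the right. *)
Let symbolMr u v t : u != 0 -> v != 0 -> t != 0 ->
  symbol u (v * t) = (symbol u v * symbol u t)%g.
Proof.
move=> u0 v0 t0; have vt0 : v * t != 0 by apply: mulf_neq0.
have uv0 : u * v != 0 by apply: mulf_neq0.
have E : (symbol u (v * t)%R * symbol v t)%g =
    (symbol u v * symbol u t * symbol v t)%g.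
  apply: (@mulIg _ (h u * (h v * h t))%g).
  transitivity (h (u * (v * t))).
    rewrite diagM // (diagM v0) // -!mulgA; congr (_ * _)%g.
    rewrite !mulgA; congr (_ * _ * _)%g.
    exact: (central_diag _ (symbol_central v0 t0) ab).
  rewrite mulrA diagM // (diagM u0) // symbolMl // !mulgA.
  congr (_ * _ * _ * _)%g; rewrite -[RHS]mulgA.
  by apply: central_symbol => c e r ce; apply: commuteMl; apply: symbol_central.
by move/mulIg: E.
Qed.

(* [[~ h v, h u]] can be read off both the action of [h u] on [h v] and the
   symbols of [u] and [v]. *)
Let symbol_skew u v : u != 0 -> v != 0 -> (symbol u v * symbol v u = 1)%g.
Proof.
move=> u0 v0.
have u0' : u^-1 != 0 by rewrite invr_eq0.
have u2 : u^-1 * u^-1 != 0 by rewrite mulf_neq0.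
have symV t : t != 0 -> (symbol t u^-1 * symbol t u = 1)%g.
  by move=> t0; rewrite -symbolMr // mulVf // (symbol1r symbolMr).
have hR : [~ h v, h u]%g = symbol v (u^-1 * u^-1).
  rewrite commgEl (diag_conj (diag_acts ab u0)) //; last first.
    by move=> e; apply: diag_entry_neq0.
  rewrite !perm1 /diag_entry eqxx (eq_sym b a) (negPf ab) eqxx.
  rewrite [_ * _ * v]mulrC diagM // !mulgA mulgK.
  by rewrite -mulgA (central_diag _ (symbol_central v0 u2) ab) mulKg.
have E : (symbol u v * (h u * h v))%g =
    (symbol v u * symbol v (u^-1 * u^-1) * (h u * h v))%g.
  rewrite -diagM // mulrC diagM // (commgC (h v)) hR -[RHS]mulgA.
  congr (_ * _)%g; apply/commute_sym.
  by apply: commuteM; apply: (central_diag _ (symbol_central v0 u2) ab).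
have zc : commute (symbol v u) (symbol v u^-1).
  by apply: central_symbol; apply: symbol_central.
by move/mulIg: E => ->; rewrite symbolMr // mulgA zc symV // mul1g symV.
Qed.

(* Both sides of [- (u * v)^-1 = - u^-1 - v^-1] are lifted to [Y], each [Y (- t^-1)]
   being [X (- t) * w t * X (- t)]. *)
Let w_mul u v : u != 0 -> v != 0 -> u + v = 1 ->
  (w u * w v)%g = (w (u * v)%R * w (v * v)%R)%g.
Proof.
move=> u0 v0 uv1; have uv0 : u * v != 0 by apply: mulf_neq0.
have ba : b != a by neq.
have [X XE] : exists X : 'F_p -> G, forall t, X t = x a b t%:P by eexists.
have [Y Y_E] : exists Y : 'F_p -> G, forall t, Y t = x b a t%:P by eexists.
have XD (s t : 'F_p) : X (s + t) = (X s * X t)%g by rewrite !XE polyCD xD.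
have YD (s t : 'F_p) : Y (s + t) = (Y s * Y t)%g by rewrite !Y_E polyCD xD.
have X0 : X 0 = 1%g by rewrite XE lift0.
have wE t : w t = (X t * Y (- t^-1)%R * X t)%g by rewrite weylE !XE Y_E.
have YE t : Y (- t^-1) = (X (- t)%R * w t * X (- t)%R)%g.
  by rewrite wE !mulgA -XD addNr X0 mul1g -mulgA -XD addrN X0 mulg1.
have XwE (s t : 'F_p) : t != 0 -> (X s * w t)%g = (w t * Y (- (s / (t * t)))%R)%g.
  move=> t0; rewrite XE Y_E conjgC (weyl_acts ab t0) // tpermL tpermR /weyl_entry eqxx.
  rewrite (negPf ba) eqxx -polyCM; congr (_ * x _ _ _)%g; congr polyC.
  by field.
have E1 : (X (- u)%R * w u * X (- 1)%R * w v * X (- v)%R)%g =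
    (X (- (u * v))%R * w (u * v)%R * X (- (u * v))%R)%g.
  have XN1 : X (- 1) = (X (- u)%R * X (- v)%R)%g by rewrite -XD -opprD uv1.
  have uvV : - (u * v)^-1 = - u^-1 - v^-1.
    by rewrite -[(u * v)^-1]mul1r -uv1; field; rewrite u0 v0.
  by rewrite -YE uvV YD !YE XN1 !mulgA.
have E2 : (w u * X (- 1)%R * w v)%g = (X (u * u)%R * w (u * v)%R * X (v * v)%R)%g.
  have uuE : u * u = u - u * v by rewrite -{3}[u]mulr1 -uv1 mulrDr addrK.
  have vvE : v * v = - (u * v) + v.
    by rewrite -{4}[v]mul1r -uv1 mulrDl addKr.
  rewrite uuE vvE !XD.
  have XV (t : 'F_p) : (X (- t)%R * X t)%g = 1%g by rewrite -XD addNr X0.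
  have XV' (t : 'F_p) : (X t * X (- t)%R)%g = 1%g by rewrite -XD addrN X0.
  apply: (@mulgI _ (X (- u)%R)); apply: (@mulIg _ (X (- v)%R)).
  rewrite !mulgA E1 XV mul1g -!mulgA XV' mulg1 //.
have E3 : (w u * w v * Y (v^-1 * v^-1)%R)%g =
    (w (u * v)%R * Y (- (v^-1 * v^-1))%R * X (v * v)%R)%g.
  rewrite -[LHS]mulgA; have := XwE (- 1) _ v0.
  rewrite mulNr opprK mul1r invfM => <-; rewrite mulgA E2 XwE //.
  by congr (_ * Y _ * _)%g; field; rewrite u0 v0.
have -> : w (v * v)%R = (Y (- (v^-1 * v^-1))%R * X (v * v)%R * Y (- (v^-1 * v^-1))%R)%g.
  rewrite weyl_swap ?mulf_neq0 // weylE invrN opprK invrK invfM.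
  by rewrite XE !Y_E.
rewrite !mulgA -E3 -!mulgA -YD addrN; by rewrite Y_E lift0 // mulg1.
Qed.

Lemma diag_conj_w v : v != 0 -> (h v ^ w (- 1)%R)%g = h v^-1.
Proof.
move=> v0; have ba : b != a by neq.
rewrite (diag_conj (weyl_acts ab n1)) //; last by move=> e; apply: weyl_entry_neq0.
rewrite tpermL tpermR /weyl_entry eqxx (negPf ba) eqxx !diagE.
rewrite invrN invr1 opprK mulr1 mulN1r mulgKA weylV //.
rewrite (weyl_swap ba) ?oppr_eq0 // (weyl_swap ba) ?opprK ?oner_eq0 //.
by rewrite invrN opprK invr1.
Qed.

Let symbol_steinberg u v : u != 0 -> v != 0 -> u + v = 1 -> symbol u v = 1%g.
Proof.
move=> u0 v0 uv1; have uv0 : u * v != 0 by apply: mulf_neq0.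
have v0' : v^-1 != 0 by rewrite invr_eq0.
have vv0 : v * v != 0 by apply: mulf_neq0.
have hw t : t != 0 -> (w 1 * h t)%g = (h t^-1 * w 1)%g.
  by move=> t0; rewrite -diag_conj_w // -weylV // conjgE invgK mulgA mulgVK.
have E : (h u * h v^-1)%g = (h (u * v)%R * h (v^-1 * v^-1)%R)%g.
  apply: (@mulIg _ (w 1 * w 1)%g).
  have := w_mul u0 v0 uv1; rewrite (weyl_diag u ab) (weyl_diag v ab).
  rewrite (weyl_diag (u * v) ab) (weyl_diag (v * v) ab).
  have hw1 (s t : 'F_p) : t != 0 -> (h s * w 1 * (h t * w 1) = h s * h t^-1 * (w 1 * w 1))%g.
    move=> t0; rewrite -!(mulgA (h s)); congr (_ * _)%g.
    by rewrite (mulgA (w 1)) hw // mulgA.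
  by rewrite !hw1 // invfM.
have : symbol u v^-1 = symbol (u * v) (v^-1 * v^-1).
  apply: invg_inj; apply: (@mulIg _ (h (u / v))).
  have vv0' : v^-1 * v^-1 != 0 by apply: mulf_neq0.
  rewrite {1}diagM // mulKg E.
  have -> : u / v = u * v * (v^-1 * v^-1) by field.
  by rewrite [in RHS]diagM // mulKg.
rewrite symbolMr ?symbolMl //.
have s1 : (symbol v v^-1 * symbol v v^-1 = 1)%g.
  have : (symbol v v * symbol v v = 1)%g by apply: symbol_skew.
  have : (symbol v v * symbol v v^-1 = 1)%g.
    by rewrite -symbolMr // mulfV // (symbol1r symbolMr).
  move=> /mulg1_eq => E1 E2; rewrite -E1 -invgM E2 invg1 //.
have zc (s t : 'F_p) : s != 0 -> t != 0 -> central (symbol s t) by apply: symbol_central.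
rewrite !mulgA -(mulgA (symbol u v^-1)).
rewrite (central_symbol _ _ (zc _ _ v0 v0')) mulgA -mulgA s1 mulg1.
rewrite -{1}[symbol u v^-1]mulg1 => /mulgI /esym E1.
by have := symbolMr u0 v0 v0'; rewrite mulfV // E1 mulg1 (symbol1r symbolMr).
Qed.

(** The symbols take values in the center, and [symbol_trivial] applies. *)
Lemma diag_mul u v : u != 0 -> v != 0 -> h (u * v) = (h u * h v)%g.
Proof.
move=> u0 v0; rewrite diagM //.
by rewrite (symbol_trivial p_pr symbolMl symbolMr symbol_skew symbol_steinberg) // mul1g.
Qed.

End Symbols.
End MonomialElements.

Arguments weyl {G p m} x a b u%_R.
Arguments diag {G p m} x a b u%_R.

(** * Reduction of rows *)

Section RowReduction.
Local Open Scope ring_scope.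
Local Open Scope classical_set_scope.
Variables (G : groupType) (p m : nat).
Hypotheses (p_pr : prime p) (m4 : (3 < #|'I_m|)%N).
Local Notation R := {poly 'F_p}.
Variable f : UMagmaMorphism.type G (SL R m).
Variable x : 'I_m -> 'I_m -> R -> G.
Hypothesis x_lift : steinberg_lift f x.

Let xD := lift_add x_lift.
Let xM := lift_mul x_lift.
Let xC := lift_com x_lift.
Local Notation weyl := (weyl x).
Local Notation diag := (diag x).
Let weyl_acts := weyl_acts m4 x_lift.
Let diag_acts := diag_acts m4 x_lift.
Let liftN := liftN x_lift.
Let lift0 := lift0 x_lift.
Let diag_mul := diag_mul p_pr m4 x_lift.

Definition act (v : 'rV[R]_m) (g : G) : 'rV[R]_m := v *m SL_mx (f g).

Lemma actM v g h : act v (g * h)%g = act (act v g) h.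
Proof. by rewrite /act gmulfM /= mulmxA. Qed.

Lemma act1 v : act v 1%g = v.
Proof. by rewrite /act gmulf1 /= mulmx1. Qed.

Lemma actE v a b r j : a != b ->
  act v (x a b r) 0 j = v 0 j + (v 0 a * r) *+ (j == b).
Proof. by move=> ab; rewrite /act (lift_mx x_lift) // row_elementary. Qed.

Lemma act_weyl v a b t j : a != b -> t != 0 ->
  act v (weyl a b t) 0 (tperm a b j) = (weyl_entry a b t j)%:P * v 0 j.
Proof.
move=> ab t0; have ba : (b == a) = false by rewrite eq_sym (negPf ab).
have tV : t%:P * (t^-1)%:P = 1 :> R by rewrite -polyCM mulfV.
rewrite weylE !actM !actE //; try neq.
rewrite !eqxx ?(negPf ab) ?ba !mulr0n !addr0 /weyl_entry.
have [->|ja] := eqVneq j a.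
  rewrite tpermL eqxx ba !mulr0n !mulr1n !addr0 polyCN.
  set A := v 0 a; set B := v 0 b.
  have -> : B + A * t%:P + (A + (B + A * t%:P) * (- (t^-1)%:P)) * t%:P =
      B * (1 - t%:P * t^-1%:P) + A * (2%:R * t%:P - t%:P * t^-1%:P * t%:P) by ring.
  by rewrite tV; ring.
have [->|jb] := eqVneq j b.
  rewrite tpermR ?eqxx ?(negPf ab) !mulr0n !mulr1n !addr0 polyCN.
  set A := v 0 a; set B := v 0 b.
  have -> : A + (B + A * t%:P) * (- (t^-1)%:P) =
      A * (1 - t%:P * t^-1%:P) - t^-1%:P * B by ring.
  by rewrite tV; ring.
by rewrite tpermD ?(negPf ja) ?(negPf jb) ?mulr0n ?addr0 ?mul1r //; neq.
Qed.

Lemma swap_after a c d r s : a != c -> c != d -> a != d ->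
  (x c d s * x a c r = x a c r * x a d (- (r * s)) * x c d s)%g.
Proof.
move=> ac cd ad; rewrite -mulgA (@xC a d c d); try neq.
rewrite mulgA (commgC (x a c r)) xM // liftN //.
by rewrite mulgK.
Qed.

Lemma swap_before a b c r s : c != a -> a != b -> c != b ->
  (x c a s * x a b r = x a b r * x c b (s * r) * x c a s)%g.
Proof.
move=> ca ab cb; rewrite (commgC (x c a s)) xM // -!mulgA.
by congr (_ * _)%g; apply: xC; neq.
Qed.

Let n1 : (-1 : 'F_p) != 0.
Proof. by rewrite oppr_eq0 oner_eq0. Qed.

(** [weyl b a t] is [weyl a b (- t^-1)], and [weyl a b 1] normalizes the torus and
    squares into it. *)
Lemma weyl_opposite a b u t : a != b -> u != 0 -> t != 0 ->
  (weyl a b u * weyl b a t)%g = diag a b (u * t).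
Proof.
move=> ab u0 t0; have ba : b != a by neq.
have w1h s : s != 0 -> (weyl a b 1 * diag a b s = diag a b s^-1 * weyl a b 1)%g.
  move=> s0; rewrite -(diag_conj_w m4 x_lift ab s0) -(weylV x_lift) //.
  by rewrite conjgE invgK mulgA mulgVK.
have w11 : (weyl a b 1 * weyl a b 1)%g = diag a b (-1).
  have E : diag a b (-1) = (weyl a b 1 * weyl a b 1)^-1%g.
    by rewrite diagE -(weylV x_lift) // invgM.
  rewrite -[LHS]invgK -E; apply: mulg1_eq.
  by rewrite -diag_mul // mulrNN mulr1 (diag1 x_lift).
have tV0 : - t^-1 != 0 by rewrite oppr_eq0 invr_eq0.
rewrite (weyl_swap m4 x_lift ba t0) (weyl_diag x_lift u ab).
rewrite (weyl_diag x_lift (- t^-1) ab) -mulgA (mulgA (weyl a b 1)) w1h //.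
rewrite -(mulgA _ _ (weyl a b 1)) w11 mulgA -!diag_mul // ?mulf_neq0 ?invr_eq0 //.
by rewrite invrN invrK; congr (diag _ _ _); ring.
Qed.

(** Stability under a generator and its inverse makes the induction over a
    generated subgroup work for statements about one-sided multiplication. *)
Lemma stable_subgroup (P : G -> Prop) :
  subgroup [set k : G | forall g, P g -> P (g * k)%g /\ P (g * k^-1)%g].
Proof.
split=> [g Pg|k l Sk Sl g Pg|k Sk g Pg]; first by rewrite invg1 mulg1.
  split; first by rewrite mulgA; apply: (Sl _ (Sk _ Pg).1).1.
  by rewrite invgM mulgA; apply: (Sk _ (Sl _ Pg).2).2.
by rewrite invgK; split; [apply: (Sk _ Pg).2 | apply: (Sk _ Pg).1].
Qed.

Lemma conj_subgroup (H : set G) y : subgroup H ->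
  subgroup [set k : G | H (k ^ y)%g].
Proof.
case=> H1 HM HV; split=> [|k l Hk Hl|k Hk] /=; first by rewrite conj1g.
  by rewrite conjMg; apply: HM.
by rewrite conjVg; apply: HV.
Qed.

Definition full (S : {set 'I_m}) : set G :=
  Defs.generated [set g | exists a b r,
    [/\ a \in S, b \in S, a != b & g = x a b r]].

Definition fixing (S : {set 'I_m}) (o : 'I_m) : set G :=
  Defs.generated [set g | exists a b r,
    [/\ a \in S, b \in S, a != b, a != o & g = x a b r]].

(** Adding a multiple of a zero entry changes nothing. *)
Definition loops (S : {set 'I_m}) (v : 'rV[R]_m) : set G :=
  Defs.generated [set g | exists a b r,
    [/\ a \in S, b \in S, a != b, v 0 a = 0 & g = x a b r]].

Section Representation.
Variables (S : {set 'I_m}) (o : 'I_m).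
Hypothesis oS : o \in S.
Local Notation A := (fixing S o).

Let unit_row i (u : 'F_p) : 'rV[R]_m := u%:P *: delta_mx 0 i.

Let unit_rowE i u j : unit_row i u 0 j = u%:P *+ (j == i).
Proof. by rewrite !mxE /= mulr_natr. Qed.

(** [leaf v g] and [rep v g] say that [g] is a standard way to carry the [o]-th
    unit row to [v], up to left multiplication by [fixing S o].  The leaves are
    the rows with a single entry, which is a nonzero constant; they are reached
    by monomial elements.  Any other row is reached from one in which some
    entry is smaller.  Different reductions of the same row give the same coset:
    this is the content of [rep_move]. *)
Inductive leaf (v : 'rV[R]_m) (g : G) : Prop :=
| leaf_weyl h i u of A h & i \in S & i != o & u != 0 &
    v = unit_row i u & g = (h * weyl o i u)%g
| leaf_diag h i u of A h & i \in S & i != o & u != 0 &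
    v = unit_row o u & g = (h * diag o i u)%g.

Inductive rep (v : 'rV[R]_m) (g : G) : Prop :=
| rep_leaf of leaf v g
| rep_step g0 a b r of a \in S & b \in S & a != b &
    (size (v 0%R b + v 0%R a * r)%R < size (v 0%R b))%N &
    rep (act v (x a b r)) g0 & g = (g0 * x a b (- r)%R)%g.

Let A_gen a b r : a \in S -> b \in S -> a != b -> a != o -> A (x a b r).
Proof. by move=> aS bS ab ao; apply: generated_gen; exists a, b, r. Qed.

Let A_weyl a b t : a \in S -> b \in S -> a != b -> a != o -> b != o ->
  A (weyl a b t).
Proof.
move=> aS bS ab ao bo; rewrite weylE.
by apply: generatedM; [apply: generatedM|]; apply: A_gen; neq.
Qed.

Let tperm_S i j c : i \in S -> j \in S -> c \in S -> tperm i j c \in S.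
Proof. by move=> iS jS cS; case: tpermP => // ->. Qed.

Lemma acts_pull g (s : {perm 'I_m}) rho a b r : acts_as x g s rho ->
    (forall c, rho c != 0) -> a != b ->
  exists r', (g * x a b r = x (s^-1 a)%g (s^-1 b)%g r' * g)%g.
Proof.
move=> gs rho0 ab; set c := (s^-1 a)%g; set e := (s^-1 b)%g.
have ce : c != e by apply: contra ab => /eqP/perm_inj ->.
exists (((rho c)^-1 * rho e)^-1%:P * r)%R.
rewrite [RHS]conjgC gs // /c /e !permKV; congr (_ * x _ _ _)%g.
by rewrite mulrA -polyCM mulfV ?mul1r // mulf_neq0 ?invr_eq0.
Qed.

Lemma acts_pull_weyl g (s : {perm 'I_m}) rho a b t : acts_as x g s rho ->
    (forall c, rho c != 0) -> a != b -> t != 0 ->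
  exists t', (g * weyl a b t = weyl (s^-1 a)%g (s^-1 b)%g t' * g)%g.
Proof.
move=> gs rho0 ab t0; set c := (s^-1 a)%g; set e := (s^-1 b)%g.
have ce : c != e by apply: contra ab => /eqP/perm_inj ->.
have k0 : (rho c)^-1 * rho e != 0 by rewrite mulf_neq0 ?invr_eq0.
exists (((rho c)^-1 * rho e)^-1 * t)%R.
rewrite [RHS]conjgC (weyl_conj gs) //; last first.
  by rewrite mulf_neq0 ?invr_eq0.
by rewrite /c /e !permKV mulVKf.
Qed.

Let leaf_loop v g a b r : leaf v g -> v 0 a = 0 ->
  a \in S -> b \in S -> a != b -> leaf v (g * x a b r)%g.
Proof.
move=> lf va aS bS ab; case: lf => h i u Ah iS io u0 vE ->.
  have oi : o != i by neq.
  have ai : a != i.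
    move: va; rewrite vE unit_rowE; case: eqP => // _ /eqP.
    by rewrite polyC_eq0 (negPf u0).
  have [r' E] := acts_pull r (weyl_acts oi u0)
    (fun c => weyl_entry_neq0 _ _ c u0) ab.
  rewrite -mulgA E tpermV mulgA; apply: (leaf_weyl _ iS io u0 vE) => //.
  apply: generatedM => //; apply: A_gen; rewrite ?tperm_S //.
    by apply: contra ab => /eqP/perm_inj ->.
  by case: tpermP ai => [-> //|-> /eqP //|/eqP ? ?].
have oi : o != i by neq.
have ao : a != o.
  move: va; rewrite vE unit_rowE; case: eqP => // _ /eqP.
  by rewrite polyC_eq0 (negPf u0).
have [r' E] := acts_pull r (diag_acts oi u0)
  (fun c => diag_entry_neq0 _ _ c u0) ab.
rewrite -mulgA E invg1 !perm1 mulgA; apply: (leaf_diag _ iS io u0 vE) => //.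
by apply: generatedM => //; apply: A_gen.
Qed.

(** A reduction of [v] conjugates loops at [v] into loops at the reduced row: it
    does not touch a zero entry, and does not use it either. *)
Lemma rep_loop v g k : rep v g -> loops S v k -> rep v (g * k)%g.
Proof.
move=> vg; elim: vg k => {v g} [v g lf|v g g0 c d s cS dS cd sz _ IH ->] k vk.
  have st : forall g', leaf v g' -> leaf v (g' * k)%g /\ leaf v (g' * k^-1)%g.
    move: k vk; apply: (generated_min (stable_subgroup (leaf v))).
    move=> _ [a [b [r]]] [aS bS ab va ->] h lh.
    by rewrite -liftN //; split; apply: leaf_loop.
  by apply: rep_leaf; apply: (st _ lf).1.
suff : loops S (act v (x c d s)) (k ^ x c d s)%g.
  move/IH => E; apply: (rep_step cS dS cd sz E).
  by rewrite liftN // conjgE !mulgA mulgK.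
move: k vk.
apply: (generated_min (conj_subgroup (x c d s) (generated_subgroup _))).
move=> _ [a [b [r [aS bS ab va ->]]]] /=.
have ca : c != a by apply: contraTneq sz => ->; rewrite va mul0r addr0 ltnn.
have da : d != a by apply: contraTneq sz => ->; rewrite va size_poly0.
have va' : act v (x c d s) 0 a = 0 by rewrite actE // va eq_sym (negPf da) addr0.
have gen b' r' : b' \in S -> a != b' -> loops S (act v (x c d s)) (x a b' r').
  by move=> b'S ab'; apply: generated_gen; exists a, b', r'.
have [bc|bc] := eqVneq b c; last by rewrite conj_commute; [apply: gen|apply: xC; neq].
rewrite {}bc in ab bS *; rewrite commgMR xM //; last by neq.
by apply: generatedM; apply: gen => //; neq.
Qed.

Let leaf_weyl_first v g a b t u : leaf v g -> a \in S -> b \in S -> a != b ->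
  t != 0 -> u != 0 -> v = unit_row a u -> leaf (unit_row b (u * t)) (g * weyl a b t)%g.
Proof.
move=> lf aS bS ab t0 u0 va; have ut0 : u * t != 0 by apply: mulf_neq0.
have inj i j s r : r != 0 -> unit_row i r = unit_row j s -> i = j /\ r = s.
  move=> r0 /rowP/(_ i); rewrite !unit_rowE eqxx mulr1n.
  case: eqP => [->|_]; first by rewrite mulr1n => /polyC_inj.
  by rewrite mulr0n => /eqP; rewrite polyC_eq0 (negPf r0).
case: lf => h i s Ah iS io s0 vE ->.
  have [ia su] := inj _ _ _ _ s0 (etrans (esym vE) va).
  rewrite {}ia {}su {vE i s s0} in iS io *.
  have oa : o != a by neq.
  have [bo|bo] := eqVneq b o.
    rewrite {}bo in ab bS *.
    apply: (leaf_diag Ah aS io ut0 erefl).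
    by rewrite -mulgA weyl_opposite.
  have wab : A (weyl a b t) by apply: A_weyl.
  apply: (leaf_weyl (generatedM Ah wab) bS bo ut0 erefl).
  rewrite -!mulgA; congr (_ * _)%g; rewrite conjgC; congr (_ * _)%g.
  rewrite (weyl_conj (weyl_acts ab t0)) //; last by move=> c; apply: weyl_entry_neq0.
  rewrite tpermL tpermD; try neq; rewrite /weyl_entry eqxx (negPf oa).
  by rewrite (eq_sym o) (negPf bo) invr1 mul1r mulrC.
have [oa su] := inj _ _ _ _ s0 (etrans (esym vE) va).
rewrite -{}oa in aS ab va *; rewrite {}su {vE s s0} in va *.
have oi : o != i by neq.
have bo : b != o by neq.
(* All the [diag o j u] lie in the same coset of [A]. *)
have [k Ak ->] : exists2 k, A k & diag o i u = (k * diag o b u)%g.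
  have [->|ib] := eqVneq i b; first by exists 1%g; rewrite ?mul1g //; apply: generated1.
  pose g' := weyl i b 1; have Ag' : A g' by apply: A_weyl.
  have E : (diag o i u ^ g')%g = diag o b u.
    rewrite (diag_conj x_lift (weyl_acts ib (oner_neq0 _))) //; last first.
      by move=> c; apply: weyl_entry_neq0; apply: oner_neq0.
    rewrite tpermL tpermD; try neq; rewrite /weyl_entry eqxx (negPf oi).
    rewrite (negPf (_ : o != b)) ?invr1 ?mul1r; last by neq.
    by rewrite (diag1 x_lift) ?invg1 ?mulg1 //; neq.
  have ob : o != b by neq.
  have [t' Et] := acts_pull_weyl (diag_acts ob u0)
    (fun c => diag_entry_neq0 o b c u0) ib (oner_neq0 _).
  rewrite invg1 !perm1 -/g' in Et.
  exists (g' * (weyl i b t')^-1)%g.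
    by apply: generatedM => //; apply: generatedV; apply: A_weyl.
  rewrite -[LHS](conjgK g') E conjgE invgK -mulgA; congr (_ * _)%g.
  by apply: (@mulgI _ (weyl i b t')); rewrite mulVKg mulgA -Et mulgK.
apply: (leaf_weyl (generatedM Ah Ak) bS bo ut0 erefl).
rewrite -!mulgA; do 2!congr (_ * _)%g.
rewrite (weyl_diag x_lift t ab) (weyl_diag x_lift (u * t) ab) mulgA.
by rewrite -diag_mul.
Qed.

Let act_unit_row i u (s : {perm 'I_m}) a b t : s = tperm a b -> a != b -> t != 0 ->
  act (unit_row i u) (weyl a b t) = unit_row (s i) (weyl_entry a b t i * u).
Proof.
move=> -> ab t0; apply/rowP => j; rewrite -[j](permK (tperm a b)) tpermV.
rewrite act_weyl // !unit_rowE (inj_eq perm_inj).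
by case: eqP => [->|_]; rewrite ?mulr0 // !mulr1n polyCM.
Qed.

Let leaf_weyl_move v g a b t : leaf v g -> a \in S -> b \in S -> a != b ->
  t != 0 -> leaf (act v (weyl a b t)) (g * weyl a b t)%g.
Proof.
move=> lf aS bS ab t0.
have [i [u [u0 vE]]] : exists i u, u != 0 /\ v = unit_row i u.
  by case: lf => [h i u _ _ _ u0 -> _|h i u _ _ _ u0 -> _]; [exists i, u | exists o, u].
rewrite [in act _ _]vE (act_unit_row _ _ erefl) // /weyl_entry.
have [ia|ia] := eqVneq i a.
  rewrite ia tpermL mulrC; apply: (leaf_weyl_first lf) => //.
  by rewrite vE ia.
have [ib|ib] := eqVneq i b.
  rewrite ib tpermR (weyl_swap m4 x_lift) // mulrC.
  have t0' : - t^-1 != 0 by rewrite oppr_eq0 invr_eq0.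
  by apply: (leaf_weyl_first lf) => //; rewrite ?vE ?ib //; neq.
rewrite tpermD ?mul1r; try neq.
have inj j r s : r != 0 -> unit_row j r = unit_row i s -> j = i.
  move=> r0 /rowP/(_ j); rewrite !unit_rowE eqxx mulr1n.
  by case: eqP => // _ /eqP; rewrite mulr0n polyC_eq0 (negPf r0).
case: lf => h j r Ah jS jo r0 rE ->.
  have ji := inj _ _ _ r0 (etrans (esym rE) vE).
  have oj : o != j by neq.
  have [t' E] := acts_pull_weyl (weyl_acts oj r0)
    (fun c => weyl_entry_neq0 o j c r0) ab t0.
  rewrite -mulgA E tpermV mulgA.
  have Aw : A (weyl (tperm o j a) (tperm o j b) t').
    apply: A_weyl; rewrite ?tperm_S //; first by rewrite (inj_eq perm_inj).
      by apply: contra ia => /eqP E'; rewrite -[a](permK (tperm o j)) tpermV E' tpermL ji eqxx.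
    by apply: contra ib => /eqP E'; rewrite -[b](permK (tperm o j)) tpermV E' tpermL ji eqxx.
  by apply: (leaf_weyl (generatedM Ah Aw) jS jo r0); rewrite -?vE.
have oi := inj _ _ _ r0 (etrans (esym rE) vE).
have oj : o != j by neq.
have [t' E] := acts_pull_weyl (diag_acts oj r0)
  (fun c => diag_entry_neq0 o j c r0) ab t0.
rewrite -mulgA E invg1 !perm1 mulgA.
have Aw : A (weyl a b t') by apply: A_weyl => //; rewrite oi; neq.
by apply: (leaf_diag (generatedM Ah Aw) jS jo r0); rewrite -?vE.
Qed.

(** Monomial elements permute the entries up to scalars, so they carry reductions
    to reductions. *)
Lemma rep_weyl v g a b t : rep v g -> a \in S -> b \in S -> a != b ->
  t != 0 -> rep (act v (weyl a b t)) (g * weyl a b t)%g.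
Proof.
move=> vg aS bS ab t0.
elim: vg => {v g} [v g lf|v g g0 c d s cS dS cd sz _ IH ->].
  exact/rep_leaf/leaf_weyl_move.
set w := weyl a b t in IH *; set q := tperm a b.
have rho0 e := weyl_entry_neq0 a b e t0.
set k := ((weyl_entry a b t c)^-1 * weyl_entry a b t d)%:P.
have xw r : (x c d r * w = w * x (q c) (q d) (k * r)%R)%g.
  by rewrite conjgC (weyl_acts ab t0).
have qcd : q c != q d by rewrite (inj_eq perm_inj).
have E : act (act v (x c d s)) w = act (act v w) (x (q c) (q d) (k * s)).
  by rewrite -!actM xw.
rewrite {}E in IH; apply: (rep_step _ _ qcd _ IH); rewrite ?tperm_S //.
  rewrite !act_weyl // /k.
  set e := weyl_entry a b t c; set e' := weyl_entry a b t d.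
  have -> : e'%:P * v 0 d + e%:P * v 0 c * ((e^-1 * e')%:P * s) =
      e'%:P * (v 0 d + v 0 c * s).
    have ee : e%:P * e^-1%:P = 1 :> R by rewrite -polyCM mulfV ?rho0.
    rewrite polyCM.
    have -> : e%:P * v 0 c * (e^-1%:P * e'%:P * s) =
      (e%:P * e^-1%:P) * (e'%:P * (v 0 c * s)) by ring.
    by rewrite ee; ring.
  by rewrite !mul_polyC !size_scale ?rho0.
by rewrite -mulgA xw mulrN mulgA.
Qed.

Definition weight (v : 'rV[R]_m) : nat := (\sum_j size (v 0%R j))%N.

Lemma weight_lt (v w : 'rV[R]_m) c : (size (w 0%R c) < size (v 0%R c))%N ->
  (forall j, j != c -> (size (w 0%R j) <= size (v 0%R j))%N) ->
  (weight w < weight v)%N.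
Proof.
move=> wc wj; rewrite /weight (bigD1 c) //= [X in (_ < X)%N](bigD1 c) //=.
by rewrite -addSn leq_add //; apply: leq_sum => j; apply: wj.
Qed.

Let size_cancel (P Q : R) : (size (P + Q)%R < size P)%N -> size Q = size P.
Proof.
case: (ltngtP (size Q) (size P)) => // lt.
  by rewrite size_polyDl // ltnn.
by rewrite addrC size_polyDl // ltnNge ltnW.
Qed.

Let size_add_le (P Q : R) k : (size P <= k)%N -> (size Q <= k)%N ->
  (size (P + Q)%R <= k)%N.
Proof. by move=> Pk Qk; apply: leq_trans (size_polyD _ _) _; rewrite geq_max Pk. Qed.

Let size_add_lt (P Q : R) k : (size P < k)%N -> (size Q < k)%N ->
  (size (P + Q)%R < k)%N.
Proof. by case: k => // k Pk Qk; apply: size_add_le. Qed.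

Let size_mul_le (P Q T : R) : (size P <= size Q)%N ->
  (size (P * T)%R <= size (Q * T)%R)%N.
Proof.
have [->|P0] := eqVneq P 0; first by rewrite mul0r size_poly0.
have [->|T0] := eqVneq T 0; first by rewrite !mulr0 leqnn.
move=> PQ; have Q0 : Q != 0 by rewrite -size_poly_gt0 (leq_trans _ PQ) // size_poly_gt0.
rewrite !size_mul //; move: (size P) (size Q) (size T) PQ => i j k; lia.
Qed.

Let size_mul_lt (P Q T : R) : (size P < size Q)%N -> T != 0 ->
  (size (P * T)%R < size (Q * T)%R)%N.
Proof.
move=> PQ T0; have Q0 : Q != 0 by rewrite -size_poly_gt0; apply: leq_trans PQ.
have [->|P0] := eqVneq P 0.
  by rewrite mul0r size_poly0 size_poly_gt0 mulf_neq0.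
rewrite !size_mul //; move: T0; rewrite -size_poly_gt0.
move: (size P) (size Q) (size T) PQ => i j k; lia.
Qed.

Section Down.
Variables (v : 'rV[R]_m).
Hypothesis move_below : forall w h a b r, (weight w < weight v)%N -> rep w h ->
  a \in S -> b \in S -> a != b -> rep (act w (x a b r)) (h * x a b r)%g.

Let back c d s a b r g0 h : h = (x c d (- s) * x a b r)%g -> c != d ->
  rep (act (act v (x c d s)) h) (g0 * h)%g ->
  rep (act v (x a b r)) (g0 * x c d (- s) * x a b r)%g.
Proof.
move=> hE cd; rewrite -actM.
suff -> : (x c d s * h = x a b r)%g by rewrite hE mulgA.
by rewrite hE liftN // mulVKg.
Qed.

(* Two reductions of the same entry.  Performing both may give back an entry of
   the original size, so the larger of the two entries in use is first reduced
   by the other one. *)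
Let down_same_target a c b r s g0 : a \in S -> c \in S -> b \in S ->
  a != b -> c != b -> a != c ->
  (size (v 0%R b + v 0%R a * r)%R < size (v 0%R b))%N ->
  (size (v 0%R b + v 0%R c * s)%R < size (v 0%R b))%N ->
  rep (act v (x c b s)) g0 ->
  rep (act v (x a b r)) (g0 * x c b (- s) * x a b r)%g.
Proof.
move=> aS cS bS ab cb ac za zc R1.
have [ba bc ca] : [/\ b != a, b != c & c != a] by split; neq.
have va0 : v 0 a != 0 by apply: contraTneq za => ->; rewrite mul0r addr0 ltnn.
have vc0 : v 0 c != 0 by apply: contraTneq zc => ->; rewrite mul0r addr0 ltnn.
have r0 : r != 0 by apply: contraTneq za => ->; rewrite mulr0 addr0 ltnn.
have s0 : s != 0 by apply: contraTneq zc => ->; rewrite mulr0 addr0 ltnn.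
have za' := size_cancel za; have zc' := size_cancel zc.
have ne := (eqxx, negPf ab, negPf ba, negPf ac, negPf ca, negPf bc, negPf cb).
have below (w : 'rV[R]_m) e : e != b -> (size (w 0%R b) < size (v 0%R b))%N ->
    (size (w 0%R e) <= size (v 0%R e))%N ->
    (forall j, j != b -> j != e -> w 0 j = v 0 j) -> (weight w < weight v)%N.
  move=> eb wb we wj; apply: (weight_lt wb) => j jb.
  by have [->//|je] := eqVneq j e; rewrite wj.
have W1 : (weight (act v (x c b s)) < weight v)%N.
  apply: (below _ c) => // [||j jb jc]; rewrite actE //.
  - by rewrite eqxx.
  - by rewrite !ne addr0.
  - by rewrite (negPf jb) addr0.
have [ac_size|/ltnW ca_size] := leqP (size (v 0 a)) (size (v 0 c)).
  pose q := - (v 0 c %/ v 0 a).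
  have qE : v 0 c + v 0 a * q = v 0 c %% v 0 a.
    by rewrite {1}(divp_eq (v 0 c) (v 0 a)) /q mulrN [_ * (_ %/ _)]mulrC addrAC subrr add0r.
  have rho_a : (size (v 0 c %% v 0 a)%R < size (v 0%R a))%N by rewrite ltn_modp.
  have rho_c := leq_trans rho_a ac_size.
  apply: (@back _ _ _ _ _ _ _
    (x a c q * x c b (- s) * x a b (r + q * s) * x a c (- q))%g) => //.
    transitivity ((x c b (- s) * x a b (r + q * s)) ^ x a c (- q))%g.
      by rewrite conjgE -liftN // opprK !mulgA.
    rewrite conjMg (conj_before x_lift) // (conj_com x_lift); try neq.
    rewrite -mulgA -xD // mulrNN; congr (_ * x _ _ _)%g; ring.
  rewrite !mulgA !actM.
  have z3 : (size (v 0%R b + v 0%R c * s - (v 0%R c %% v 0%R a) * s)%R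
      < size (v 0%R b))%N.
    by rewrite size_add_lt // size_polyN -zc' size_mul_lt.
  have R2 := move_below q W1 R1 aS cS ac.
  have W2 : (weight (act (act v (x c b s)) (x a c q)) < weight v)%N.
    apply: (below _ c) => // [||j jb jc]; rewrite !actE // ?ne.
    - by rewrite mulr0n mulr1n addr0.
    - by rewrite !mulr0n mulr1n !addr0 qE ltnW.
    - by rewrite (negPf jb) (negPf jc) !addr0.
  have R3 := move_below (- s) W2 R2 cS bS cb.
  have W3 : (weight (act (act (act v (x c b s)) (x a c q)) (x c b (- s))) < weight v)%N.
    apply: (below _ c) => // [||j jb jc]; rewrite !actE // ?ne.
    - by rewrite !mulr0n !mulr1n !addr0 qE mulrN.
    - by rewrite !mulr0n mulr1n !addr0 qE ltnW.
    - by rewrite (negPf jb) (negPf jc) !addr0.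
  have R4 := move_below (r + q * s) W3 R3 aS bS ab.
  apply: move_below => //; apply: (below _ c) => // [||j jb jc]; rewrite !actE // ?ne.
  - rewrite !mulr0n !mulr1n !addr0.
    set B := v 0 b in za *; set C := v 0 c; set D := v 0 a in za *.
    suff -> : B + C * s + (C + D * q) * (- s) + D * (r + q * s) = B + D * r by [].
    by ring.
  - by rewrite !mulr0n mulr1n !addr0 qE ltnW.
  - by rewrite (negPf jb) (negPf jc) !addr0.
pose q := - (v 0 a %/ v 0 c).
have qE : v 0 a + v 0 c * q = v 0 a %% v 0 c.
  by rewrite {1}(divp_eq (v 0 a) (v 0 c)) /q mulrN [_ * (_ %/ _)]mulrC addrAC subrr add0r.
have rho_c : (size (v 0 a %% v 0 c)%R < size (v 0%R c))%N by rewrite ltn_modp.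
have rho_a := leq_trans rho_c ca_size.
apply: (@back _ _ _ _ _ _ _
  (x c a q * x a b r * x c b (- s - q * r) * x c a (- q))%g) => //.
  transitivity ((x a b r * x c b (- s - q * r)) ^ x c a (- q))%g.
    by rewrite conjgE -liftN // opprK !mulgA.
  rewrite conjMg (conj_before x_lift) // (conj_com x_lift); try neq.
  rewrite -mulgA -xD // mulNr opprK addrC subrK.
  by apply: xC; neq.
rewrite !mulgA !actM.
have z3 : (size (v 0%R b + v 0%R c * s + (v 0%R a %% v 0%R c) * r)%R
    < size (v 0%R b))%N.
  by rewrite size_add_lt // -za' size_mul_lt.
have R2 := move_below q W1 R1 cS aS ca.
have W2 : (weight (act (act v (x c b s)) (x c a q)) < weight v)%N.
  apply: (below _ a) => // [||j jb ja]; rewrite !actE // ?ne.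
  - by rewrite mulr0n mulr1n addr0.
  - by rewrite !mulr0n mulr1n !addr0 qE ltnW.
  - by rewrite (negPf jb) (negPf ja) !addr0.
have R3 := move_below r W2 R2 aS bS ab.
have W3 : (weight (act (act (act v (x c b s)) (x c a q)) (x a b r)) < weight v)%N.
  apply: (below _ a) => // [||j jb ja]; rewrite !actE // ?ne.
  - by rewrite !mulr0n !mulr1n !addr0 qE.
  - by rewrite !mulr0n mulr1n !addr0 qE ltnW.
  - by rewrite (negPf jb) (negPf ja) !addr0.
have R4 := move_below (- s - q * r) W3 R3 cS bS cb.
apply: move_below => //; apply: (below _ a) => // [||j jb ja]; rewrite !actE // ?ne.
- rewrite !mulr0n !mulr1n !addr0.
  set B := v 0 b in za *; set C := v 0 c; set D := v 0 a in za *.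
  suff -> : B + C * s + (D + C * q) * r + C * (- s - q * r) = B + D * r by [].
  by ring.
- by rewrite !mulr0n mulr1n !addr0 qE ltnW.
- by rewrite (negPf jb) (negPf ja) !addr0.
Qed.

(* Reductions of different entries commute up to one more root element, and the
   rows on the way from one reduction to the other weigh less than [v]. *)
Let down_disjoint a b c d r s g0 : a \in S -> b \in S -> c \in S -> d \in S ->
  a != b -> c != d -> b != d -> ~~ ((a == d) && (b == c)) ->
  (size (v 0%R b + v 0%R a * r)%R < size (v 0%R b))%N ->
  (size (v 0%R d + v 0%R c * s)%R < size (v 0%R d))%N ->
  rep (act v (x c d s)) g0 ->
  rep (act v (x a b r)) (g0 * x c d (- s) * x a b r)%g.
Proof.
move=> aS bS cS dS ab cd bd adbc za zc R1.
have [ba dc db] : [/\ b != a, d != c & d != b] by split; neq.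
have za' := size_cancel za; have zc' := size_cancel zc.
have ne := (eqxx, negPf ab, negPf ba, negPf cd, negPf dc, negPf bd, negPf db).
have below (w : 'rV[R]_m) : (size (w 0%R d) < size (v 0%R d))%N ->
    (size (w 0%R b) <= size (v 0%R b))%N ->
    (forall j, j != b -> j != d -> w 0 j = v 0 j) -> (weight w < weight v)%N.
  move=> wd wb wj; apply: (weight_lt wd) => j jd.
  by have [->//|jb] := eqVneq j b; rewrite wj.
have below' (w : 'rV[R]_m) : (size (w 0%R b) < size (v 0%R b))%N ->
    (size (w 0%R d) <= size (v 0%R d))%N ->
    (forall j, j != b -> j != d -> w 0 j = v 0 j) -> (weight w < weight v)%N.
  move=> wb wd wj; apply: (weight_lt wb) => j jb.
  by have [->//|jd] := eqVneq j d; rewrite wj.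
have W1 : (weight (act v (x c d s)) < weight v)%N.
  apply: below => // [||j jb jd]; rewrite actE // ?ne ?addr0 //.
  by rewrite (negPf jd) addr0.
have R2 := move_below r W1 R1 aS bS ab.
have [ad|ad] := eqVneq a d.
  rewrite {}ad in aS ab ba za za' ne adbc W1 R2 *; rewrite eqxx /= in adbc.
  have cb : c != b by neq.
  apply: (@back _ _ _ _ _ _ _ (x d b r * x c b (- s * r) * x c d (- s))%g) => //.
    by rewrite swap_before.
  rewrite !mulgA !actM.
  have W2 : (weight (act (act v (x c d s)) (x d b r)) < weight v)%N.
    apply: below => [||j jb jd]; rewrite !actE // ?ne ?mulr0n ?mulr1n ?addr0 //.
      rewrite mulrDl addrA; apply: size_add_le; first exact: ltnW.
      by rewrite -za' size_mul_le // zc'.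
    by rewrite (negPf jb) (negPf jd) !addr0.
  have R3 := move_below (- s * r) W2 R2 cS bS cb.
  apply: move_below => //.
  apply: below' => [||j jb jd]; rewrite !actE // ?ne ?(negPf cb) ?mulr0n ?mulr1n ?addr0 //.
  - set B := v 0 b in za *; set C := v 0 c; set D := v 0 d in za *.
    suff -> : B + (D + C * s) * r + C * (- s * r) = B + D * r by [].
    by ring.
  - exact: ltnW.
  - by rewrite (negPf jb) (negPf jd) !addr0.
have [bc|bc] := eqVneq b c.
  rewrite -{}bc in cS cd dc zc zc' ne adbc W1 R1 R2 *.
  apply: (@back _ _ _ _ _ _ _ (x a b r * x a d (- (r * - s)) * x b d (- s))%g) => //.
    by rewrite swap_after.
  rewrite !mulgA !actM.
  have W2 : (weight (act (act v (x b d s)) (x a b r)) < weight v)%N.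
    apply: below' => [||j jb jd]; rewrite !actE // ?ne ?(negPf ad) ?mulr0n ?mulr1n ?addr0 //.
      exact: ltnW.
    by rewrite (negPf jb) (negPf jd) !addr0.
  have R3 := move_below (- (r * - s)) W2 R2 aS dS ad.
  apply: move_below => //.
  apply: below' => [||j jb jd]; rewrite !actE // ?ne ?(negPf ad) ?mulr0n ?mulr1n ?addr0 //.
    apply: size_add_le; first exact: ltnW.
    have -> : v 0 a * - (r * - s) = v 0 a * r * s by ring.
    by rewrite -zc'; apply: size_mul_le; rewrite za'.
  by rewrite (negPf jb) (negPf jd) !addr0.
apply: (@back _ _ _ _ _ _ _ (x a b r * x c d (- s))%g) => //.
  by apply/commute_sym/xC; neq.
rewrite !mulgA !actM; apply: move_below => //.
apply: below' => [||j jb jd]; rewrite !actE // ?ne ?(negPf ad) ?mulr0n ?mulr1n ?addr0 //.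
  exact: ltnW.
by rewrite (negPf jb) (negPf jd) !addr0.
Qed.

(* Two entries of the same size, either of which can be reduced by the other:
   the reductions differ by a monomial element. *)
Let down_opposite a b r s g0 : a \in S -> b \in S -> a != b ->
  (size (v 0%R b + v 0%R a * r)%R < size (v 0%R b))%N ->
  (size (v 0%R a + v 0%R b * s)%R < size (v 0%R a))%N ->
  rep (act v (x b a s)) g0 ->
  rep (act v (x a b r)) (g0 * x b a (- s) * x a b r)%g.
Proof.
move=> aS bS ab zb za R1; have ba : b != a by neq.
have va0 : v 0 a != 0 by apply: contraTneq za => ->; rewrite size_poly0.
have vb0 : v 0 b != 0 by apply: contraTneq zb => ->; rewrite size_poly0.
have r0 : r != 0 by apply: contraTneq zb => ->; rewrite mulr0 addr0 ltnn.
have s0 : s != 0 by apply: contraTneq za => ->; rewrite mulr0 addr0 ltnn.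
have za' := size_cancel za; have zb' := size_cancel zb.
(* Equal sizes force [r] and [s] to be constants, and then the vanishing of both
   leading coefficients forces [r * s = 1]. *)
have [r1 s1] : size r = 1%N /\ size s = 1%N.
  move: za' zb' r0 s0 va0 vb0; rewrite -!size_poly_gt0 => + + r0 s0 va0 vb0.
  rewrite !size_mul -?size_poly_gt0 //.
  move: (size r) (size s) (size (v 0 a)) (size (v 0 b)) r0 s0 va0 vb0 => i j k l.
  by lia.
have /size_poly1P[r' r'0 rE] : size r == 1%N by apply/eqP.
have /size_poly1P[s' s'0 sE] : size s == 1%N by apply/eqP.
have rs : s' = r'^-1.
  have ab_size : size (v 0 a) = size (v 0 b).
    by rewrite -za' sE mulrC mul_polyC size_scale.
  have cb : lead_coef (v 0 b) + lead_coef (v 0 a) * r' = 0.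
    have lt : (size (v 0%R b + r' *: v 0%R a)%R <= (size (v 0%R b)).-1)%N.
      by move: zb; rewrite rE [_ * _%:P]mulrC mul_polyC; case: (size (v 0 b)).
    have := nth_default 0 lt; rewrite coefD coefZ.
    by rewrite /lead_coef ab_size mulrC.
  have ca : lead_coef (v 0 a) + lead_coef (v 0 b) * s' = 0.
    have lt : (size (v 0%R a + s' *: v 0%R b)%R <= (size (v 0%R a)).-1)%N.
      by move: za; rewrite sE [_ * _%:P]mulrC mul_polyC; case: (size (v 0 a)).
    have := nth_default 0 lt; rewrite coefD coefZ.
    by rewrite /lead_coef -ab_size mulrC.
  have la : lead_coef (v 0 a) != 0 by rewrite lead_coef_eq0.
  have : lead_coef (v 0 a) * (1 - r' * s') = 0.
    have -> : lead_coef (v 0 a) * (1 - r' * s') =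
        lead_coef (v 0 a) + lead_coef (v 0 b) * s' -
        (lead_coef (v 0 b) + lead_coef (v 0 a) * r') * s' by ring.
    by rewrite ca cb mul0r subr0.
  move/eqP; rewrite mulf_eq0 (negPf la) /= subr_eq0 => /eqP rs.
  by apply: (mulfI r'0); rewrite -rs mulfV.
apply: (@back _ _ _ _ _ _ _ (x a b (- r) * weyl a b r')%g) => //.
  by rewrite weylE -rE -rs sE polyCN !mulgA -xD // addNr lift0 // mul1g.
rewrite mulgA actM; apply: rep_weyl => //; apply: move_below => //.
by apply: (weight_lt (c := a)) => [|j ja]; rewrite actE // ?eqxx // (negPf ja) addr0.
Qed.

(** The reduction which [rep] records need not be the given one. *)
Lemma rep_down g a b r : rep v g -> a \in S -> b \in S -> a != b ->
  (size (v 0%R b + v 0%R a * r)%R < size (v 0%R b))%N ->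
  rep (act v (x a b r)) (g * x a b r)%g.
Proof.
case=> [lf|g0 c d s cS dS cd zc R1 ->] aS bS ab za.
  have [i [u vE]] : exists i u, v = unit_row i u.
    by case: lf => [h i u _ _ _ _ -> _|h i u _ _ _ _ -> _]; [exists i, u | exists o, u].
  move: za; rewrite vE !unit_rowE; case: eqP => [<-|_].
    by rewrite (negPf ab) mul0r addr0 ltnn.
  by rewrite size_poly0.
have [bd|bd] := eqVneq b d.
  rewrite -{}bd in cd dS zc R1 *.
  have [ac|ac] := eqVneq a c; last exact: down_same_target.
  rewrite -{}ac in cS cd zc R1 *.
  apply: (@back _ _ _ _ _ _ _ (x a b (r - s))%g) => //.
    by rewrite -xD // addrC.
  apply: move_below => //; apply: (weight_lt (c := b)) => [|j jb]; rewrite actE //.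
    by rewrite eqxx.
  by rewrite (negPf jb) addr0.
have [/andP[/eqP ad /eqP bc]|adbc] := boolP ((a == d) && (b == c)).
  rewrite -{}ad -{}bc in cd dS cS zc R1 *; exact: down_opposite.
exact: down_disjoint.
Qed.

End Down.

(** Dividing the entry [b] by the entry [a] splits any move into a reduction
    followed by the inverse of a reduction. *)
Lemma rep_move v g a b r : rep v g -> a \in S -> b \in S -> a != b ->
  rep (act v (x a b r)) (g * x a b r)%g.
Proof.
have [k] := ubnP (weight v).
elim: k v g a b r => // k IH v g a b r; rewrite ltnS => vk vg aS bS ab.
have ba : b != a by neq.
have down := @rep_down v (fun w h a' b' r' wv => IH w h a' b' r' (leq_trans wv vk)).
have [va|va] := eqVneq (v 0 a) 0.
  have -> : act v (x a b r) = v.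
    by apply/rowP => j; rewrite actE // va mul0r mul0rn addr0.
  by apply: rep_loop => //; apply: generated_gen; exists a, b, r.
pose q := - (v 0 b %/ v 0 a).
have qE : v 0 b + v 0 a * q = v 0 b %% v 0 a.
  by rewrite {1}(divp_eq (v 0 b) (v 0 a)) /q mulrN [_ * (_ %/ _)]mulrC addrAC subrr add0r.
have rho : (size (v 0%R b %% v 0%R a)%R < size (v 0%R a))%N by rewrite ltn_modp.
have R1 : rep (act v (x a b q)) (g * x a b q)%g.
  have [lt|ge] := ltnP (size (v 0 b %% v 0 a)) (size (v 0 b)).
    by apply: down => //; rewrite qE.
  have q0 : q = 0 by rewrite /q divp_small ?oppr0 // (leq_ltn_trans ge).
  by rewrite q0 lift0 // mulg1 act1.
have [lt|ge] := ltnP (size (v 0 b %% v 0 a)) (size (v 0 b + v 0 a * r)).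
  apply: (@rep_step _ _ (g * x a b q)%g a b (q - r)) => //.
  - rewrite !actE // !eqxx (negPf ab) mulr0n !mulr1n addr0.
    have -> : v 0 b + v 0 a * r + v 0 a * (q - r) = v 0 b + v 0 a * q by ring.
    by rewrite qE.
  - by rewrite -actM -xD // addrC subrK.
  - by rewrite opprB -mulgA -xD // addrC subrK.
suff -> : r = q by [].
apply/eqP; rewrite -subr_eq0; case: (eqVneq (r - q) 0) => // rq.
have : (size (v 0%R a * (r - q))%R < size (v 0%R a))%N.
  have -> : v 0 a * (r - q) = (v 0 b + v 0 a * r) - (v 0 b + v 0 a * q) by ring.
  by rewrite qE size_add_lt ?size_polyN // (leq_ltn_trans ge).
rewrite size_mul //; move: va rq; rewrite -!size_poly_gt0.
by move: (size (v 0 a)) (size (r - q)) => i j; lia.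
Qed.

(** By [rep_move] the element [y] is a standard way to carry the unit row to
    itself; no reduction of that row exists, and the only leaves there are the
    elements of [fixing S o]. *)
Lemma full_stabilizer y : (1 < #|S|)%N -> full S y ->
  act (delta_mx 0 o) y = delta_mx 0 o -> fixing S o y.
Proof.
move=> S2 Sy yE.
have [i iS io] : exists2 i, i \in S & i != o.
  have : (0 < #|S :\ o|)%N by move: S2; rewrite (cardsD1 o) oS.
  by case/card_gt0P => i; rewrite in_setD1 => /andP[io iS]; exists i.
have e1 : delta_mx 0 o = unit_row o 1 by rewrite /unit_row scale1r.
have oi : o != i by neq.
have r1 : rep (delta_mx 0 o) 1%g.
  have u1 : (1 : 'F_p) != 0 by apply: oner_neq0.
  apply: rep_leaf; have A1 : A 1%g by apply: generated1.
  apply: (leaf_diag A1 iS io u1) => //.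
  by rewrite mul1g (diag1 x_lift).
have : rep (act (delta_mx 0 o) y) (1 * y)%g.
  pose P (k : G) := forall v g, rep v g -> rep (act v k) (g * k)%g.
  suff [Py _] : P y /\ P y^-1%g by apply: Py.
  move: y Sy {yE}; apply: generated_min => [|_ [a [b [r [aS bS ab ->]]]]].
    split=> [|k l [Pk Pk'] [Pl Pl']|k [Pk Pk']]; last by rewrite invgK.
      by rewrite invg1; split=> v g; rewrite act1 mulg1.
    split=> v g vg; first by rewrite actM mulgA; apply/Pl/Pk.
    by rewrite invgM actM mulgA; apply/Pk'/Pl'.
  by rewrite -liftN //; split=> v g vg; apply: rep_move.
rewrite yE mul1g; case=> [lf|g0 a b r aS bS ab lt _ _].
  have inj j u : u != 0 -> delta_mx 0 o = unit_row j u -> j = o /\ u = 1.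
    rewrite e1 => u0 /rowP/(_ j); rewrite !unit_rowE eqxx mulr1n.
    case: eqP => [->|_]; first by rewrite mulr1n => /polyC_inj.
    by rewrite mulr0n => /eqP; rewrite eq_sym polyC_eq0 (negPf u0).
  case: lf => h j u Ah jS jo u0 uE ->.
    by case: (inj _ _ u0 uE) => jo'; rewrite jo' eqxx in jo.
  case: (inj _ _ u0 uE) => _ ->; rewrite (diag1 x_lift) ?mulg1 //; neq.
move: lt; rewrite e1 !unit_rowE; case: eqP => [<-|_].
  by rewrite (negPf ab) mul0r addr0 ltnn.
by rewrite size_poly0.
Qed.

End Representation.

Hypothesis f_tf : kernel_has_no_torsion f p.

Let x_exp a b r : a != b -> (x a b r ^+ p)%g = 1%g.
Proof.
move=> ab; have xX k : (x a b r ^+ k)%g = x a b (r *+ k).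
  by elim: k => [|k IH]; rewrite ?mulr0n ?lift0 // expgS IH mulrS xD.
by rewrite xX -mulr_natl -polyC_natr pchar_Fp_0 // polyC0 mul0r lift0.
Qed.

Let fixes (u : 'cV[R]_m) : set G := [set k | SL_mx (f k) *m u = u].

Let fixes_subgroup u : subgroup (fixes u).
Proof.
split=> [|k l|k] /=; first by rewrite /fixes /= gmulf1 mul1mx.
  by rewrite /fixes /= gmulfM /= -mulmxA => fk ->.
rewrite /fixes /= => fk; rewrite -{1}fk mulmxA.
have := congr1 (fun g => SL_mx (f g)) (mulVg k); rewrite gmulfM gmulf1 /= => ->.
by rewrite mul1mx.
Qed.

Let elementary_fixes a b r j : a != b -> j != b -> fixes (delta_mx j 0) (x a b r).
Proof.
move=> ab jb; rewrite /fixes /= (lift_mx x_lift) // /elementary_mx mulmxDl mul1mx.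
by rewrite -scalemxAl mul_delta_mx_cond eq_sym (negPf jb) mulr0n scaler0 addr0.
Qed.

Section Induction.
Variables (S : {set 'I_m}) (o : 'I_m).
Hypothesis oS : o \in S.

Let column : set G :=
  Defs.generated [set g | exists a r, [/\ a \in S, a != o & g = x a o r]].

Let column_gen a r : a \in S -> a != o -> column (x a o r).
Proof. by move=> aS ao; apply: generated_gen; exists a, r. Qed.

Let column_commute c c' : column c -> column c' -> commute c c'.
Proof.
move=> Cc Cc'; move: c' Cc'.
apply: (generated_min (subgroup_centralizer c)) => _ [a [r [aS ao ->]]] /=.
apply: commute_sym; move: c Cc.
apply: (generated_min (subgroup_centralizer _)) => _ [b [s [bS bo ->]]] /=.
by apply: xC; neq.
Qed.

Let column_exp c : column c -> (c ^+ p)%g = 1%g.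
Proof.
move=> Cc; suff: (column `&` [set k | (k ^+ p)%g = 1%g]) c by case.
move: c Cc; apply: generated_min => [|_ [a [r [aS ao ->]]]]; last first.
  by split; [exact: column_gen | exact: x_exp].
split=> [|k l [Ck kp] [Cl lp]|k [Ck kp]].
- by split; [exact: generated1 | exact: expg1n].
- by split; [exact: generatedM | rewrite /= expgMn ?kp ?lp ?mulg1 //; exact: column_commute].
- by split; [exact: generatedV | rewrite /= expVgn kp invg1].
Qed.

Let column_conj y c : full (S :\ o) y -> column c -> column (c ^ y)%g.
Proof.
pose P (y : G) := forall c, column c -> column (c ^ y)%g.
move=> Sy Cc; suff [Py _] : P y /\ P y^-1%g by apply: Py.
move: y Sy; apply: generated_min => [|_ [a [b [r [+ + ab ->]]]]].
  split=> [|k l [Pk Pk'] [Pl Pl']|k [Pk Pk']]; last by rewrite invgK.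
    by rewrite invg1; split=> c'; rewrite conjg1.
  by split=> c' Cc'; rewrite ?invgM conjgM; auto.
rewrite !in_setD1 => /andP[ao aS] /andP[bo bS].
suff Px s : P (x a b s) by rewrite -liftN.
move=> c'; apply: (generated_min (conj_subgroup _ (generated_subgroup _))).
move=> _ [e [t [eS eo ->]]] /=.
have [->|eb] := eqVneq e b; last first.
  by rewrite (conj_com x_lift); [apply: column_gen | neq..].
rewrite (conj_before x_lift) //; try neq.
by apply: generatedM; apply: column_gen.
Qed.

Lemma fixing_factor y : fixing S o y ->
  exists c y', [/\ column c, full (S :\ o) y' & y = (c * y')%g].
Proof.
move: y; apply: generated_min => [|_ [a [b [r [aS bS ab ao ->]]]]]; last first.
  have [bo|bo] := eqVneq b o.
    exists (x a b r), 1%g; split; rewrite ?mulg1 // ?bo; first exact: column_gen.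
    exact: generated1.
  exists 1%g, (x a b r); split; rewrite ?mul1g //; first exact: generated1.
  by apply: generated_gen; exists a, b, r; rewrite !in_setD1 ao bo.
split=> [|k l [c [z [Cc Sz ->]]] [c' [z' [Cc' Sz' ->]]]|k [c [z [Cc Sz ->]]]].
- by exists 1%g, 1%g; split; rewrite ?mulg1 //; exact: generated1.
- exists (c * c' ^ z^-1)%g, (z * z')%g; split.
  + by apply: generatedM => //; apply: column_conj => //; apply: generatedV.
  + exact: generatedM.
  + by rewrite conjgE invgK !mulgA mulgVK.
- exists (c^-1 ^ z)%g, z^-1%g; split.
  + by apply: column_conj => //; apply: generatedV.
  + exact: generatedV.
  + by rewrite conjgE invgM -!mulgA mulgV mulg1.
Qed.

(** [c] fixes the unit columns other than the [o]-th one, which [y'] fixes; so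
    both lift the identity as soon as their product does. *)
Lemma column_kernel c y' : column c -> full (S :\ o) y' -> f (c * y')%g = 1%g ->
  c = 1%g.
Proof.
move=> Cc Sy' cy; apply: f_tf; last exact: column_exp.
have Fc j : fixes (delta_mx j 0) c.
  have [jo|jo] := eqVneq j o; last first.
    move: c Cc {cy}; apply: (generated_min (fixes_subgroup _)) => _ [a [r [aS ao ->]]].
    exact: elementary_fixes.
  have Fy : fixes (delta_mx o 0) y'.
    move: y' Sy' {cy}; apply: (generated_min (fixes_subgroup _)).
    move=> _ [a [b [r [_ + ab ->]]]].
    by rewrite in_setD1 => /andP[bo _]; apply: elementary_fixes; neq.
  rewrite /fixes /= jo -{1}Fy mulmxA.
  by have := congr1 (@SL_mx _ _) cy; rewrite gmulfM /= => ->; rewrite mul1mx.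
apply: val_inj; apply/matrixP => i j /=.
have := Fc j; rewrite /fixes /= => /colP/(_ i).
rewrite !mxE (bigD1 j) //= mxE !eqxx mulr1 big1 ?addr0 => [-> //|k kj].
  by rewrite andbT.
by rewrite mxE (negPf kj) mulr0.
Qed.

End Induction.

(** An element of the kernel fixes a unit row, so by [full_stabilizer] it is the
    product of a column, which is trivial, and of an element using one index
    less. *)
Lemma full_injective S y : full S y -> f y = 1%g -> y = 1%g.
Proof.
have [k] := ubnP #|S|; elim: k S y => // k IH S y; rewrite ltnS => Sk Sy fy.
have [S1|S2] := leqP #|S| 1.
  suff sub1 : subgroup [set 1%g : G].
    move: y Sy {fy}; apply: generated_min => // g [a [b [r [aS bS ab _]]]].
    by move/card_le1_eqP: S1 ab => /(_ _ _ aS bS) ->; rewrite eqxx.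
  by split=> // [_ _ -> ->|_ ->]; rewrite ?mulg1 ?invg1.
have [o oS] : exists o, o \in S by apply/card_gt0P; apply: ltnW.
have : fixing S o y by apply: full_stabilizer => //; rewrite /act fy mulmx1.
move/fixing_factor => [c [y' [Cc Sy' yE]]].
have c1 : c = 1%g by apply: (column_kernel Cc Sy'); rewrite -yE.
rewrite yE c1 mul1g in fy *; apply: (IH (S :\ o)) => //.
by move: Sk; rewrite (cardsD1 o) oS.
Qed.

End RowReduction.

(** * The cyclic order and the subgroups *)

Section CyclicPositions.
Variable n : nat.
Implicit Types i a b c d e : 'I_n.+1.

(** The number of steps of the cycle from [i] to [a]. *)
Definition pos i a : nat := if i <= a then a - i else a + n.+1 - i.

Lemma pos_lt i a : pos i a < n.+1.
Proof.
by rewrite /pos; case: ifP; have := ltn_ord a; have := ltn_ord i; lia.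
Qed.

Lemma pos_inj i : injective (pos i).
Proof.
move=> a b; rewrite /pos => E; apply: val_inj => /=; move: E.
by case: ifP; case: ifP; have := ltn_ord a; have := ltn_ord b; have := ltn_ord i; lia.
Qed.

Lemma pos_gt0 a b : a != b -> 0 < pos a b.
Proof.
move=> ab; have {ab} : nat_of_ord a <> b by move=> /val_inj ab'; rewrite ab' eqxx in ab.
by rewrite /pos; case: ifP; have := ltn_ord a; have := ltn_ord b; lia.
Qed.

Lemma pos_diag a : pos a a = 0.
Proof. by rewrite /pos leqnn subnn. Qed.

Lemma gamma0X k (j : 'I_n.+1) : ((gamma0 n ^+ k)%g j : nat) = (j + k) %% n.+1.
Proof.
elim: k => [|k IH]; first by rewrite expg0 perm1 addn0 modn_small.
rewrite expgSr permM permE /= IH -addn1 modnDml addn1 addnS //.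
Qed.

Lemma pos_gamma0 i (j : 'I_n.+1) : pos i ((gamma0 n ^+ i)%g j) = j.
Proof.
rewrite /pos gamma0X; have [lt|ge] := ltnP (j + i) n.+1.
  by rewrite modn_small //; case: ifP; have := ltn_ord j; have := ltn_ord i; lia.
have -> : (j + i) %% n.+1 = j + i - n.+1.
  by rewrite -{1}(subnK ge) modnDr modn_small //; have := ltn_ord j; have := ltn_ord i; lia.
by case: ifP; have := ltn_ord j; have := ltn_ord i; lia.
Qed.

Lemma pos_rot a b c : a != b -> b != c -> a != c -> pos a b < pos a c ->
  pos b c < pos b a.
Proof.
move=> ab bc ac.
have {ab} : nat_of_ord a <> b by move=> /val_inj ab'; rewrite ab' eqxx in ab.
have {bc} : nat_of_ord b <> c by move=> /val_inj bc'; rewrite bc' eqxx in bc.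
have {ac} : nat_of_ord a <> c by move=> /val_inj ac'; rewrite ac' eqxx in ac.
rewrite /pos; do 4!case: ifP; have := ltn_ord a; have := ltn_ord b;
  by have := ltn_ord c; lia.
Qed.

Lemma pos_rot2 a b c : a != b -> b != c -> a != c -> pos a b < pos a c ->
  pos c a < pos c b.
Proof.
move=> ab bc ac abc; have := pos_rot ab bc ac abc.
by apply: pos_rot => //; rewrite eq_sym.
Qed.

Lemma pos_total a b c : b != c -> (pos a b < pos a c) || (pos a c < pos a b).
Proof. by move=> bc; rewrite -neq_ltn; apply: contra bc => /eqP/pos_inj ->. Qed.

End CyclicPositions.

Section Subgroups.
Variables (n p : nat).
Hypothesis p_pr : prime p.
Local Open Scope ring_scope.
Local Notation R := {poly 'F_p}.
Local Notation K := (@K_ n p).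

(** A total version of [elementary], without the proof that [a != b]. *)
Definition elem (a b : 'I_n.+1) (r : R) : SL R n.+1 :=
  insubd (1%g : SL R n.+1) (elementary_mx a b r).

Lemma elem_mx a b r : a != b -> SL_mx (elem a b r) = elementary_mx a b r.
Proof. by move=> ab; apply: insubdK; apply: det_elementary_mx. Qed.

Lemma elem_eq (a b : 'I_n.+1) r (g : SL R n.+1) : a != b ->
  SL_mx g = elementary_mx a b r -> g = elem a b r.
Proof. by move=> ab gE; apply: val_inj; rewrite /= gE elem_mx. Qed.

Lemma elemD a b r s : a != b -> (elem a b r * elem a b s)%g = elem a b (r + s).
Proof. by move=> ab; apply: elem_eq => //=; rewrite !elem_mx // elementary_mxD. Qed.

Lemma elemC a b c e r s : a != b -> c != e -> b != c -> a != e ->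
  commute (elem a b r) (elem c e s).
Proof.
by move=> ab ce bc ae; apply: val_inj; rewrite /= !elem_mx // elementary_mxC.
Qed.

Lemma elemR a b c r s : a != b -> b != c -> a != c ->
  [~ elem a b r, elem b c s]%g = elem a c (r * s).
Proof.
move=> ab bc ac; apply: (@mulgI _ (elem b c s * elem a b r)%g).
by rewrite -commgC; apply: val_inj; rewrite /= !elem_mx // elementary_mxR.
Qed.

(** Entries further from the diagonal are commutators with constant entries. *)
Lemma K_elem i a b (r : R) : (pos i a < pos i b)%N -> (size r <= 4)%N -> K i (elem a b r).
Proof.
have [l] := ubnP (pos i b); elim: l b r => // l IH b r; rewrite ltnS => lb lt r4.
have ab : a != b by apply: contraTneq lt => ->; rewrite ltnn.
have [j jE] : exists j : 'I_n.+1, a = (gamma0 n ^+ i)%g j.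
  by exists (Ordinal (pos_lt i a)); apply: (@pos_inj _ i); rewrite pos_gamma0.
have ex k : (k < n.+1)%N -> exists c : 'I_n.+1, pos i c = k /\
    exists2 j : 'I_n.+1, j = k :> nat & c = (gamma0 n ^+ i)%g j.
  move=> kn; exists ((gamma0 n ^+ i)%g (Ordinal kn)); rewrite pos_gamma0.
  by split=> //; exists (Ordinal kn).
have gen c e (s : R) : pos i e = (pos i c).+1 -> (size s <= 4)%N -> K i (elem c e s).
  move=> ce s4; have cn := pos_lt i c; have en := pos_lt i e.
  have [c' [/pos_inj -> [jc jcE cE]]] := ex _ cn.
  have [e' [/pos_inj -> [je jeE eE]]] := ex _ en.
  have ce' : (gamma0 n ^+ i)%g jc != (gamma0 n ^+ i)%g je.
    rewrite -cE -eE; apply/eqP => cee; move: ce; rewrite cee; lia.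
  apply: generated_gen; exists jc, je, s, ce'; split=> //.
    by rewrite jcE jeE.
  by apply/esym/elem_eq; rewrite ?cE ?eE.
have [ba|ba] := eqVneq (pos i b) (pos i a).+1; first exact: gen.
have [c [cE _]] : exists c, pos i c = (pos i b).-1 /\ True.
  have [|c [cE _]] := ex (pos i b).-1; last by exists c.
  by have := pos_lt i b; move: lt; lia.
have ac : a != c by apply/eqP => acE; move: cE ba lt; rewrite acE; lia.
have cb : c != b by apply/eqP => cbE; move: cE lt; rewrite cbE; lia.
rewrite -[r]mulr1 -(elemR _ _ ac cb ab).
have K1 : K i (elem a c r) by apply: IH => //; move: cE lb lt ba; lia.
have K2 : K i (elem c b 1) by apply: gen; rewrite ?size_poly1 //; move: cE lt; lia.
by rewrite /commg /conjg; do !apply: generatedM => //; apply: generatedV.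
Qed.

End Subgroups.

(** * Compatible lifts of the subgroups *)

Section Sections.
Local Open Scope ring_scope.
Local Open Scope classical_set_scope.
Variables (n p : nat) (G : groupType).
Hypotheses (n3 : (3 <= n)%N) (p_pr : prime p) (p_odd : odd p).
Local Notation R := {poly 'F_p}.
Local Notation I := 'I_n.+1.
Local Notation K := (@K_ n p).
Variable f : UMagmaMorphism.type G (SL R n.+1).
Hypothesis f_tf : kernel_has_no_torsion f p.
Variable k : I -> SL R n.+1 -> G.
Hypothesis kM : forall i g h, K i g -> K i h -> k i (g * h)%g = (k i g * k i h)%g.
Hypothesis fk : forall i g, K i g -> f (k i g) = g.
Hypothesis k_eq : forall i j g, K i g -> K j g -> k i g = k j g.

Let I4 : (3 < #|'I_n.+1|)%N.
Proof. by rewrite card_ord ltnS. Qed.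

Let k1 i : k i 1%g = 1%g.
Proof.
have K1 : K i 1%g by apply: generated1.
by have := kM K1 K1; rewrite mulg1 -{1}[k i 1%g]mulg1 => /mulgI.
Qed.

Let kV i g : K i g -> k i g^-1%g = (k i g)^-1%g.
Proof.
move=> Kg; have KgV : K i g^-1%g by apply: generatedV.
by apply/esym/mulg1_eq; rewrite -kM // mulgV k1.
Qed.

Let kR i g h : K i g -> K i h -> k i [~ g, h]%g = [~ k i g, k i h]%g.
Proof.
move=> Kg Kh; have KgV := generatedV Kg; have KhV := generatedV Kh.
by rewrite /commg /conjg !kM ?kV //; do !apply: generatedM => //.
Qed.

(* The lift of an elementary matrix of degree at most 3; any [i] whose cyclic order
   puts [a] before [b] gives the same element. *)
Let z a b r := k a (elem a b r).

Let k_elem i a b (r : R) : (pos i a < pos i b)%N -> (size r <= 4)%N ->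
  k i (elem a b r) = z a b r.
Proof.
move=> iab r4; apply: k_eq; apply: K_elem => //; rewrite pos_diag pos_gt0 //.
by apply: contraTneq iab => ->; rewrite ltnn.
Qed.

Let K_own a b (r : R) : a != b -> (size r <= 4)%N -> K a (elem a b r).
Proof. by move=> ab r4; apply: K_elem; rewrite // pos_diag pos_gt0. Qed.

Let zD a b (r s : R) : a != b -> (size r <= 4)%N -> (size s <= 4)%N ->
  z a b (r + s) = (z a b r * z a b s)%g.
Proof. by move=> ab r4 s4; rewrite /z -elemD // kM //; apply: K_own. Qed.

Let z_mx a b (r : R) : a != b -> (size r <= 4)%N ->
  SL_mx (f (z a b r)) = elementary_mx a b r.
Proof. by move=> ab r4; rewrite fk ?elem_mx //; apply: K_own. Qed.

Let zX a b (r : R) j : a != b -> (size r <= 4)%N -> (z a b r ^+ j)%g = z a b (r *+ j).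
Proof.
move=> ab r4; elim: j => [|j IH].
  rewrite /z; have -> : elem a b (r *+ 0) = 1%g; last by rewrite k1.
  by apply/esym/elem_eq; rewrite // /elementary_mx scale0r addr0.
rewrite expgS IH mulrS zD //.
have [j0|j0] := eqVneq (j%:R : 'F_p) 0.
  by rewrite -mulr_natl -polyC_natr j0 polyC0 mul0r size_poly0.
by rewrite -mulr_natl -polyC_natr mul_polyC size_scale.
Qed.

Let z_exp a b (r : R) : a != b -> (size r <= 4)%N -> (z a b r ^+ p)%g = 1%g.
Proof.
move=> ab r4; rewrite zX // -mulr_natl -polyC_natr pchar_Fp_0 // polyC0 mul0r.
rewrite /z; have -> : elem a b (0 : R) = 1%g; last by rewrite k1.
by apply/esym/elem_eq; rewrite // /elementary_mx scale0r addr0.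
Qed.

Let zR a b c (r s : R) : a != b -> b != c -> a != c -> (pos a b < pos a c)%N ->
  (size r <= 4)%N -> (size s <= 4)%N -> (size (r * s)%R <= 4)%N ->
  [~ z a b r, z b c s]%g = z a c (r * s).
Proof.
move=> ab bc ac abc r4 s4 rs4; rewrite -(k_elem abc s4) -kR.
- by rewrite elemR.
- exact: K_own.
- exact: K_elem.
Qed.

Let zC (i a b c e : I) (r s : R) : b != c -> a != e ->
  (pos i a < pos i b)%N -> (pos i c < pos i e)%N ->
  (size r <= 4)%N -> (size s <= 4)%N -> commute (z a b r) (z c e s).
Proof.
move=> bc ae iab ice r4 s4; rewrite -(k_elem iab r4) -(k_elem ice s4) /commute.
rewrite -!kM; try exact: K_elem.
by rewrite elemC //; [apply: contraTneq iab | apply: contraTneq ice] => ->;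
  rewrite ltnn.
Qed.

Let middle (a b : I) : {c | a != b -> a != c /\ c != b}.
Proof.
apply: cid; have [c [ca cb _]] := avoid_three I4 a b b.
by exists c => _; split=> //; rewrite eq_sym.
Qed.

Let mid a b := sval (middle a b).

(** Up to degree 3 these are given by the lifts [k]; beyond, the commutator
    formula for one middle index is the definition. *)
Fixpoint monomial_lift (a b : I) (t : nat) : G :=
  if t is t'.+1 then
    if (t'.+1 <= 3)%N then z a b 'X^(t'.+1)
    else [~ monomial_lift a (mid a b) t', z (mid a b) b 'X]%g
  else z a b 1.

Local Notation y := monomial_lift.

Let y_low a b t : (t <= 3)%N -> y a b t = z a b 'X^t.
Proof. by case: t => [|t] //= ->. Qed.

Let Xn4 t : (t <= 3)%N -> (size ('X^t : R) <= 4)%N.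
Proof. by rewrite size_polyXn. Qed.

Let y_next d a c : (3 <= d)%N -> a != c -> exists b,
  [/\ a != b, b != c & y a c d.+1 = [~ y a b d, y b c 1]%g].
Proof.
move=> d3 ac; exists (mid a c); have [am mc] := svalP (middle a c) ac.
by split=> //=; rewrite ltnNge d3 /=.
Qed.

Let y_mx a b t : a != b -> SL_mx (f (y a b t)) = elementary_mx a b 'X^t.
Proof.
elim: t a b => [|t IH] a b ab; first by rewrite z_mx // size_poly1.
have [t3|t3] := leqP t.+1 3; first by rewrite y_low // z_mx ?Xn4.
have [c [ac cb ->]] := y_next (t3 : (3 <= t)%N) ab.
have fE : f (y a c t) = elem a c 'X^t by apply: elem_eq => //; apply: IH.
have fE' : f (y c b 1) = elem c b 'X^1.
  by apply: elem_eq => //; rewrite y_low // z_mx // Xn4.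
by rewrite gmulfR fE fE' elemR // elem_mx // -exprD addn1.
Qed.

Let y_f_com a b c e i j : a != b -> c != e -> b != c -> a != e ->
  commute (f (y a b i)) (f (y c e j)).
Proof.
move=> ab ce bc ae; apply: val_inj; rewrite /= !y_mx //; exact: elementary_mxC.
Qed.

Let y_exp a b i : a != b -> (i <= 3)%N -> (y a b i ^+ p)%g = 1%g.
Proof. by move=> ab i3; rewrite y_low // z_exp ?Xn4. Qed.

Let y_mul_direct a b c i j : a != b -> b != c -> a != c ->
  (pos a b < pos a c)%N -> (i + j <= 3)%N -> [~ y a b i, y b c j]%g = y a c (i + j).
Proof.
move=> ab bc ac abc ij.
rewrite !y_low ?zR -?exprD ?Xn4 //; lia.
Qed.

Let y_com_direct (o a b c e : I) i j : b != c -> a != e ->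
  (pos o a < pos o b)%N -> (pos o c < pos o e)%N ->
  (i <= 3)%N -> (j <= 3)%N -> commute (y a b i) (y c e j).
Proof. by move=> *; rewrite !y_low //; apply: (@zC o); rewrite ?Xn4. Qed.

(* If no subgroup contains both elements, the indices are in the cyclic order
   [a], [e], [c], [b], and both elements are commutators with the factor
   [y c b 0]. *)
Let y_com a b c e i j : a != b -> c != e -> b != c -> a != e ->
  (i <= 3)%N -> (j <= 3)%N -> commute (y a b i) (y c e j).
Proof.
move=> ab ce bc ae i3 j3.
have [ac|ac] := eqVneq a c.
  by apply: (@y_com_direct a) => //; rewrite -?ac pos_diag pos_gt0 // ac.
have [ace|ace] := boolP (pos a c < pos a e)%N.
  by apply: (@y_com_direct a) => //; rewrite pos_diag pos_gt0.
have [cab|cab] := boolP (pos c a < pos c b)%N.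
  by apply: (@y_com_direct c) => //; rewrite pos_diag pos_gt0.
have aec : (pos a e < pos a c)%N by have := pos_total a ce; rewrite (negPf ace).
have cba : (pos c b < pos c a)%N by have := pos_total c ab; rewrite (negPf cab).
have acb : (pos a c < pos a b)%N by apply: pos_rot2 => //; neq.
have cbe : (pos c b < pos c e)%N.
  by apply: ltn_trans cba _; apply: pos_rot2 => //; neq.
have xE : y a b i = [~ y a c i, y c b 0]%g.
  by rewrite y_mul_direct ?addn0 //; neq.
have be : b != e.
  by apply: contraTneq cbe => ->; rewrite ltnn.
have yE : y c e j = [~ y c b 0, y b e j]%g.
  by rewrite y_mul_direct ?add0n //; neq.
have bac : (pos b a < pos b c)%N by apply: pos_rot => //; neq.
apply: (neighbour_commutators_commute f_tf xE yE) => //.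
- apply: (@y_com_direct b); rewrite ?pos_diag ?pos_gt0 //; neq.
- by apply: (@y_com_direct a); rewrite ?pos_diag ?pos_gt0 //; neq.
- by apply: (@y_com_direct a); rewrite ?pos_diag ?pos_gt0 //; neq.
- by apply: (@y_com_direct c); rewrite ?pos_diag ?pos_gt0 //; neq.
- apply: (@y_com_direct c); rewrite ?pos_diag ?pos_gt0 //; neq.
- exact: y_exp.
- exact: y_exp.
- by apply: y_f_com; neq.
Qed.

Let multiplies (a b c : I) := forall i j, (i + j <= 3)%N ->
  [~ y a b i, y b c j]%g = y a c (i + j).

(* The commutator of [y a b] and [y b c] also is that of [y a d] and [y d c]; it
   therefore commutes with [y a b], hence has exponent [p], and
   [commuting_lifts_eq] identifies it. *)
Let multiplies_chain (a d b c : I) : a != d -> a != b -> a != c -> d != b -> d != c ->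
  b != c -> multiplies a d b -> multiplies d b c ->
  multiplies a b c /\ multiplies a d c.
Proof.
move=> ad ab ac db dc bc adb dbc.
suff E i j : (i + j <= 3)%N -> [~ y a b i, y b c j]%g = y a c (i + j) /\
    [~ y a d i, y d c j]%g = y a c (i + j).
  by split=> i j /E[].
move=> ij; have [i3 j3] : (i <= 3)%N /\ (j <= 3)%N by lia.
have P : [~ y a d i, y d b 0]%g = y a b i by rewrite adb addn0.
have Q : [~ y d b 0, y b c j]%g = y d c j by rewrite dbc.
have [| | |] := @shift_commutator _ (y a d i) (y d b 0) (y b c j).
- by apply: y_com; neq.
- by rewrite P; apply: y_com; neq.
- by rewrite P Q; apply: y_com; neq.
rewrite P Q => E PE; rewrite -E.
suff -> : [~ y a b i, y b c j]%g = y a c (i + j) by [].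
apply: (commuting_lifts_eq f_tf).
- by apply/commute_sym/commuteR; apply: y_com; neq.
- by rewrite -commXg // y_exp // comm1g.
- by rewrite y_exp.
apply: (@mulgI _ (f (y b c j) * f (y a b i))%g).
rewrite gmulfR -commgC; apply: val_inj; rewrite /= !y_mx //.
by rewrite elementary_mxR // -exprD.
Qed.

Let y_mul a b c : a != b -> b != c -> a != c -> multiplies a b c.
Proof.
have direct a' b' c' : a' != b' -> b' != c' -> a' != c' ->
    (pos a' b' < pos a' c')%N -> multiplies a' b' c'.
  by move=> *; move=> i j; apply: y_mul_direct.
(* the fourth index lies on the arc from [b] to [a] *)
have outer a' b' c' d : a' != b' -> b' != c' -> a' != c' -> d != a' -> d != b' ->
    d != c' -> (pos a' c' < pos a' b')%N -> (pos a' b' < pos a' d)%N ->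
    multiplies a' b' c'.
  move=> ab bc ac da db dc acb abd.
  have bda : (pos b' d < pos b' a')%N by apply: pos_rot => //; neq.
  have cba : (pos c' b' < pos c' a')%N by apply: pos_rot => //; neq.
  have bac : (pos b' a' < pos b' c')%N by apply: pos_rot => //; neq.
  have := @multiplies_chain a' b' d c'.
  case; try neq; try by apply: direct; neq.
  by apply: direct; try neq; apply: ltn_trans bac.
move=> ab bc ac.
have [abc|] := boolP (pos a b < pos a c)%N; first exact: direct.
have := pos_total a bc => /orP[-> //|acb _].
have [d [da db dc]] := avoid_three I4 a b c.
have [abd|] := boolP (pos a b < pos a d)%N; first exact: (outer a b c d).
have := @pos_total _ a b d; rewrite eq_sym db => /(_ isT)/orP[-> //|adb _].
have dba : (pos d b < pos d a)%N by apply: pos_rot => //; neq.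
have [] := @multiplies_chain a d b c; try neq.
  by apply: direct; neq.
have [acd|] := boolP (pos a c < pos a d)%N.
  apply: direct; try neq; apply: ltn_trans dba _.
  have cda : (pos c d < pos c a)%N by apply: pos_rot => //; neq.
  by apply: pos_rot => //; neq.
have := @pos_total _ a c d; rewrite eq_sym dc => /(_ isT)/orP[-> //|adc _].
have dca : (pos d c < pos d a)%N by apply: pos_rot => //; neq.
apply: (outer d b c a) => //; try neq.
have cba : (pos c b < pos c a)%N by apply: pos_rot => //; neq.
have cad : (pos c a < pos c d)%N by apply: pos_rot2 => //; neq.
by apply: pos_rot2; try neq; apply: ltn_trans cad.
Qed.

(** The lifts of the monomials of degree at most 3 satisfy the Steinberg relations;
    these extend to all polynomials, and [full_injective] concludes. *)
Lemma sections_injective g :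
  Defs.generated [set h | exists i g, K i g /\ h = k i g] g -> f g = 1%g -> g = 1%g.
Proof.
have y3 : steinberg_upto p y 3.
  split.
  - by move=> a b i ab i3; apply: y_exp.
  - by move=> a b c i j ab bc ac; apply: y_mul.
  - by move=> *; apply: y_com.
have y_st := steinberg_all f_tf I4 p_odd y_f_com (isT : 1 < 3)%N y3
  (fun d a c d3 ac => @y_next d a c d3 ac).
have [x [x_lift xy]] := steinberg_lift_of_monomials f_tf y_st y_mx.
move=> Sg; apply: (full_injective p_pr I4 x_lift f_tf (S := [set: I]%SET)).
move: g Sg; apply: generated_min => [|_ [i [g [Kg ->]]]].
  exact: generated_subgroup.
suff: (K i `&` [set g | full x [set: I]%SET (k i g)]) g by case.
move: g Kg; apply: generated_min.
  split=> [|g h [Kg Sg] [Kh Sh]|g [Kg Sg]].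
  - by split; [exact: generated1 | rewrite /= k1; exact: generated1].
  - by split; [exact: generatedM | rewrite /= kM //; exact: generatedM].
  - by split; [exact: generatedV | rewrite /= kV //; exact: generatedV].
move=> _ [j [j' [r [jj' [j'E r4 ->]]]]].
set a := (gamma0 n ^+ i)%g j in jj' *; set b := (gamma0 n ^+ i)%g j' in jj' *.
have iab : (pos i a < pos i b)%N by rewrite !pos_gamma0 j'E.
have -> : elementary jj' r = elem a b r by apply: elem_eq.
split; first exact: K_elem.
rewrite /= k_elem //.
suff [_ ->] : (size r <= 4)%N /\ z a b r = x a b r.
  by apply: generated_gen; exists a, b, r; rewrite !inE.
rewrite -[r]coefK poly_def.
apply: (big_ind (fun s : R => (size s <= 4)%N /\ z a b s = x a b s)).
- have -> : (0 : R) = 1 *+ 0 by [].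
  rewrite size_poly0 -zX ?size_poly1 // expg0; split=> //.
  by rewrite mulr0n (lift0 x_lift).
- move=> s t [s4 sE] [t4 tE]; split.
    by rewrite (leq_trans (size_polyD _ _)) // geq_max s4.
  by rewrite zD // sE tE (lift_add x_lift).
move=> t _; have t3 : (t <= 3)%N by rewrite -ltnS (leq_trans (ltn_ord t)).
split; first by rewrite (leq_trans (size_scale_leq _ _)) ?Xn4.
pose c : nat := (nth 0%R (polyseq r) t : 'F_p).
have -> : r`_t *: 'X^t = 'X^t *+ c :> R.
  by rewrite -scaler_nat natr_Zp.
rewrite -zX ?Xn4 // -y_low // -xy //.
elim: c => [|c IH]; first by rewrite mulr0n (lift0 x_lift).
by rewrite expgS IH mulrS (lift_add x_lift).
Qed.

End Sections.

(** * Cocycles on a coset complex *)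

#[local] Arguments ordered_simplices {V} X k%_nat_scope.

Section PrimeTorsion.
Local Open Scope group_scope.
Variables (p : nat) (L : groupType).
Hypotheses (p_pr : prime p) (hL : ~ exists x : L, x <> 1 /\ has_order x p).

Lemma no_prime_torsion (x : L) : x ^+ p = 1 -> x = 1.
Proof.
move=> xp; case: (pselect (x = 1)) => // x1; case: hL; exists x; split=> //.
split=> // [|k /andP[k0 kp] xk]; first exact: prime_gt0.
apply: x1; case: (egcdnP p k0) => u v E _.
have kp1 : gcdn k p = 1%N.
  apply/eqP; rewrite -/(coprime k p) coprime_sym prime_coprime //.
  by apply: contraTN kp => /(dvdn_leq k0); rewrite -leqNgt.
rewrite kp1 in E; have : x ^+ (u * k) = 1 by rewrite mulnC expgnA xk expg1n.
by rewrite E expgnDr mulnC expgnA xp expg1n mul1g.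
Qed.

End PrimeTorsion.

Section Twisted.
Local Open Scope group_scope.
Variables (G L : groupType).

(** [(g, t)] encodes the permutation [(h, l) |-> (h * g, (t h)^-1 * l)] of [G * L];
    the product is composition from left to right.  These are the permutations
    over a right translation of [G] which commute with the right action of [L],
    that is, the automorphisms of a covering with fibre [L]. *)
Definition twisted : Type := (G * (G -> L))%type.

HB.instance Definition _ := gen_eqMixin twisted.
HB.instance Definition _ := gen_choiceMixin twisted.

Definition twisted_one : twisted := (1, fun=> 1).
Definition twisted_mul (a b : twisted) : twisted :=
  (a.1 * b.1, fun h => a.2 h * b.2 (h * a.1)).
Definition twisted_inv (a : twisted) : twisted :=
  (a.1^-1, fun h => (a.2 (h * a.1^-1))^-1).

Fact twisted_mulA : associative twisted_mul.
Proof.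
move=> a b c; rewrite /twisted_mul /= mulgA; congr pair.
by apply/funext => h; rewrite !mulgA.
Qed.
Fact twisted_mul1 : left_id twisted_one twisted_mul.
Proof.
move=> [a t]; rewrite /twisted_mul /= mul1g; congr pair.
by apply/funext => h; rewrite mul1g mulg1.
Qed.
Fact twisted_mulr1 : right_id twisted_one twisted_mul.
Proof.
move=> [a t]; rewrite /twisted_mul /= mulg1; congr pair.
by apply/funext => h; rewrite mulg1.
Qed.
Fact twisted_mulV : left_inverse twisted_one twisted_inv twisted_mul.
Proof.
move=> [a t]; rewrite /twisted_mul /= mulVg; congr pair.
by apply/funext => h; rewrite mulVg.
Qed.
Fact twisted_mulrV : right_inverse twisted_one twisted_inv twisted_mul.
Proof.
move=> [a t]; rewrite /twisted_mul /= mulgV; congr pair.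
by apply/funext => h; rewrite mulgK mulgV.
Qed.

HB.instance Definition _ := isGroup.Build twisted
  twisted_mulA twisted_mul1 twisted_mulr1 twisted_mulV twisted_mulrV.

Lemma twistedM (a b : twisted) :
  a * b = (a.1 * b.1, fun h => a.2 h * b.2 (h * a.1)).
Proof. by []. Qed.

Definition base (a : twisted) : G := a.1.

Fact base_morphism : monoid.monoid_morphism base.
Proof. by []. Qed.

HB.instance Definition _ := isUMagmaMorphism.Build twisted G base base_morphism.

Lemma twistedX (t : G -> L) k :
  ((1, t) : twisted) ^+ k = (1, fun h => t h ^+ k).
Proof.
elim: k => [|k IH]; first by [].
rewrite expgS IH twistedM /= mulg1; congr pair.
by apply/funext => h; rewrite mulg1 expgS.
Qed.

(** The kernel is a power of [L]. *)
Lemma base_kernel_torsion p : (forall l : L, l ^+ p = 1 -> l = 1) ->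
  kernel_has_no_torsion base p.
Proof.
move=> L_tf [g t] /= g1; rewrite /base /= in g1; rewrite g1 twistedX => tp.
have t1 h : t h = 1 by apply: L_tf; have /(congr1 snd)/(congr1 (@^~ h)) := tp.
by congr pair; apply/funext.
Qed.

End Twisted.

Section CosetCocycles.
Local Open Scope classical_set_scope.
Local Open Scope fset_scope.
Local Open Scope group_scope.
Variables (G L : groupType) (n : nat) (K : 'I_n.+1 -> set G).
Hypothesis K_subgroup : forall i, subgroup (K i).
Local Notation X := (coset_complex K).
Local Notation V := ('I_n.+1 * set G)%type.
Local Notation vtx := (coset_vertex K).
Implicit Types (g h : G) (i j : 'I_n.+1).

Lemma left_coset_eq i g h : left_coset g (K i) h -> vtx h i = vtx g i.
Proof.
case: (K_subgroup i) => K1 KM KV [k Kk <-]; congr (_, _).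
apply/seteqP; split=> [_ [k' Kk' <-]|_ [k' Kk' <-]].
  by exists (k * k'); rewrite ?mulgA //; apply: KM.
by exists (k^-1 * k'); [apply: KM => //; apply: KV | rewrite mulgA mulgK].
Qed.

Lemma vertexM i g k : K i k -> vtx (g * k) i = vtx g i.
Proof. by move=> Kk; apply: left_coset_eq; exists k. Qed.

Lemma vertex_inj i j g h : vtx g i = vtx h j -> i = j /\ exists2 k, K i k & h = g * k.
Proof.
case=> -> E; split=> //; case: (K_subgroup j) => K1 _ _.
have : left_coset h (K j) h by exists 1; rewrite ?mulg1.
by rewrite -E => -[k Kk <-]; exists k.
Qed.

Lemma chamber_simplex g (J : seq 'I_n.+1) : J != [::] ->
  simplices X [fset v in [seq vtx g i | i <- J]].
Proof.
move=> J0; exists [set i in J]%SET, (fun=> g); split.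
- case: J J0 => // i J _; apply/finset.set0Pn; exists i.
  by rewrite finset.inE mem_head.
- move=> i j _ _; exists g; split; first by exists 1; rewrite ?mulg1 //; case: (K_subgroup i).
  by exists 1; rewrite ?mulg1 //; case: (K_subgroup j).
- apply/fsetP => v; rewrite !inE; apply/mapP/imfsetP => /= -[i iJ ->]; exists i => //.
    by rewrite finset.inE.
  by rewrite finset.inE in iJ.
Qed.

(** Two vertices of a simplex are cosets with a common element. *)
Lemma simplex_chamber (T : {fset V}) u v : simplices X T -> u \in T -> v \in T ->
  exists g i j, u = vtx g i /\ v = vtx g j.
Proof.
move=> [J [g [_ gJ ->]]] /imfsetP[i /= iJ ->] /imfsetP[j /= jJ ->].
have [h [hi hj]] := gJ i j iJ jJ.
by exists h, i, j; rewrite (left_coset_eq hi) (left_coset_eq hj).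
Qed.

Variable phi : ordered_simplices X 1 -> L.
Hypothesis phi_cocycle : cocycle1 phi.

(* [phi] as a function of the two end points, with value 1 off the edges and in
   particular on the diagonal *)
Let Phi (u v : V) : L := oapp phi 1 (insub [tuple u; v]).

Let PhiE (e : ordered_simplices X 1) : phi e = Phi (val (source e)) (val (target e)).
Proof.
rewrite /Phi; have -> : [tuple val (source e); val (target e)] = val e.
  by apply: eq_from_tnth => -[[|[|//]] k] /=; rewrite !(tnth_nth (val (source e))).
by rewrite valK.
Qed.

Let edge_sym u v : [tuple u; v] \in ordered_simplices X 1 ->
  [tuple v; u] \in ordered_simplices X 1.
Proof.
move=> /set_mem [uv Xuv]; apply/mem_set; split.
  by move: uv; rewrite /= !inE !andbT eq_sym.
suff -> : [fset w in ([tuple v; u] : seq V)] = [fset w in ([tuple u; v] : seq V)] by [].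
by apply/fsetP => w; rewrite !inE !orbF orbC.
Qed.

Let Phi_skew u v : Phi u v = (Phi v u)^-1.
Proof.
rewrite /Phi; have [uv|uv] := boolP ([tuple u; v] \in ordered_simplices X 1).
  have vu := edge_sym uv; rewrite !insubT /= phi_cocycle.1; congr (phi _)^-1.
  apply: val_inj => /=; apply: eq_from_tnth => -[[|[|//]] k] /=;
    by rewrite !(tnth_nth u).
have vu : [tuple v; u] \notin ordered_simplices X 1.
  by apply: contra uv; apply: edge_sym.
by rewrite !insubN //= invg1.
Qed.

Let Phi_triangle u v w : uniq [:: u; v; w] -> simplices X [fset x in [:: u; v; w]] ->
  Phi u v * Phi v w * Phi w u = 1.
Proof.
move=> uvw Xuvw; have tin : [tuple u; v; w] \in ordered_simplices X 2.
  by apply/mem_set.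
pose t : ordered_simplices X 2 := SigSub tin.
have := phi_cocycle.2 t; rewrite !PhiE /=.
by rewrite !(tnth_nth u).
Qed.

(* [phi] on the chamber [g], between its vertices of types [i] and [j] *)
Let F g i j : L := Phi (vtx g i) (vtx g j).

Let F_diag g i : F g i i = 1.
Proof.
rewrite /F /Phi insubN //=; apply/negP => /set_mem [] /=.
by rewrite !inE eqxx.
Qed.

Let F_skew g i j : F g i j = (F g j i)^-1.
Proof. exact: Phi_skew. Qed.

Let F_mul g i j l : F g i j * F g j l = F g i l.
Proof.
have [->|ij] := eqVneq i j; first by rewrite F_diag mul1g.
have [->|jl] := eqVneq j l; first by rewrite F_diag mulg1.
have [->|il] := eqVneq i l; first by rewrite F_diag F_skew mulVg.
apply: (@mulIg _ (F g l i)); rewrite [in RHS]F_skew mulVg.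
apply: Phi_triangle; last first.
  by have := @chamber_simplex g [:: i; j; l] isT.
by rewrite /= !inE !xpair_eqE (negPf ij) (negPf jl) (negPf il).
Qed.

Let F_vertex g k i j : K i k -> K j k -> F (g * k) i j = F g i j.
Proof. by move=> Ki Kj; rewrite /F !vertexM. Qed.

Let T := twisted G L.

(** A lift of the chamber [h] to the covering defined by [phi] is given by its
    value at the vertex of type 0.  When [g] is in [K i], the chambers [h] and
    [h * g] share the vertex of type [i], and [transport i g] moves every lift
    of [h] to the lift of [h * g] which agrees with it there. *)
Definition transport i g : twisted G L :=
  (g, fun h => F h ord0 i * F (h * g) i ord0).

Lemma transportM i g h : transport i (g * h) = transport i g * transport i h.
Proof.
rewrite twistedM /=; congr pair; apply/funext => h'.
rewrite !mulgA -(mulgA (F h' ord0 i) (F (h' * g) i ord0)).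
by rewrite (F_mul (h' * g)) F_diag mulg1.
Qed.

(** If [g] is in both subgroups, the two chambers share an edge, over which two lifts
    agreeing at one end agree. *)
Lemma transport_eq i j g : K i g -> K j g -> transport i g = transport j g.
Proof.
move=> Ki Kj; congr pair; apply/funext => h.
rewrite -(F_mul h ord0 j i) -(F_mul (h * g) i j ord0) F_vertex //.
rewrite !mulgA -(mulgA (F h ord0 j) (F h j i)).
by rewrite (F_mul h) F_diag mulg1.
Qed.

Let Gam : set (twisted G L) :=
  Defs.generated [set a | exists i g, K i g /\ a = transport i g].

Hypothesis Gam_injective : forall a, Gam a -> base a = 1 -> a = 1.

Let orbit h : set G := [set h' | exists2 a, Gam a & h = h' * base a].

Let orbitM h a : Gam a -> orbit (h * base a) = orbit h.
Proof.
move=> Ga; apply/seteqP; split=> h' [b Gb hb].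
  exists (b * a^-1); first by apply: generatedM => //; apply: generatedV.
  by rewrite gmulfM gmulfV mulgA -hb mulgK.
exists (b * a); first exact: generatedM.
by rewrite gmulfM mulgA -hb.
Qed.

(* One chamber in each orbit, and the way from it to [h]; the way is unique by
   [Gam_injective]. *)
Let rep h : G := xget 1 (orbit h).

Let path h : T := xget 1 [set a | Gam a /\ h = rep h * base a].

Let pathP h : Gam (path h) /\ h = rep h * base (path h).
Proof.
rewrite /path; case: xgetP => [a _ //|np]; exfalso.
have : orbit h (rep h).
  rewrite /rep; case: xgetP => [h' _ //|nh]; exfalso; apply: (nh h).
  by exists 1; [exact: generated1 | rewrite gmulf1 mulg1].
by case=> a Ga ha; apply: (np a).
Qed.

Let pathM h a : Gam a -> path (h * base a) = path h * a.
Proof.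
move=> Ga; have [G1 h1] := pathP (h * base a); have [G2 h2] := pathP h.
have rE : rep (h * base a) = rep h by rewrite /rep orbitM.
rewrite rE in h1; apply: divg1_eq; apply: Gam_injective.
  by apply: generatedM => //; apply: generatedV; apply: generatedM.
rewrite gmulfF gmulfM; apply: (@mulgI _ (rep h)).
by rewrite mulgA -h1 {1}h2 invgM !mulgA mulgK mulgK mulg1.
Qed.

(* Transporting the trivial lift of [rep h] to [h] *)
Let lam h : L := ((path h).2 (rep h))^-1.

Let lamM h a : Gam a -> lam (h * base a) = (a.2 h)^-1 * lam h.
Proof.
move=> Ga; rewrite /lam pathM // /rep orbitM // -/(rep h) -invgM; congr _^-1.
by rewrite twistedM /= -/(base (path h)) -(pathP h).2.
Qed.

Let psi_at i g : L := F g i ord0 * lam g.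

Let psi_atM i g k : K i k -> psi_at i (g * k) = psi_at i g.
Proof.
move=> Kk; have Gk : Gam (transport i k) by apply: generated_gen; exists i, k.
rewrite /psi_at -{2}[k]/(base (transport i k)) lamM //= invgM.
by rewrite !mulgA mulgV mul1g -F_skew.
Qed.

Let psi (v : V) : L :=
  let x := xget (ord0, 1) [set x : 'I_n.+1 * G | vtx x.2 x.1 = v] in psi_at x.1 x.2.

Let psiE i g : psi (vtx g i) = psi_at i g.
Proof.
rewrite /psi; case: xgetP => [[j h] _ /= E|/(_ (i, g)) /=]; last by case.
by have [ij [k Kk ->]] := vertex_inj E; rewrite -ij psi_atM.
Qed.

(** Transport along [Gam] chooses one lift of each chamber, such that chambers with
    a common vertex have lifts which agree there; this trivializes [phi]. *)
Lemma cocycle_is_coboundary : exists chi : cochain0 X L, phi = gauge chi (fun=> 1).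
Proof.
exists (fun v => psi (val v)); apply/funext => e; rewrite /gauge mulg1 PhiE.
have [|||g [i [j [-> ->]]]] := @simplex_chamber
  [fset w in (val e : seq V)] (val (source e)) (val (target e)).
- by case: (set_mem (valP e)).
- by rewrite inE mem_tnth.
- by rewrite inE mem_tnth.
rewrite !psiE /psi_at invgM !mulgA mulgK -/(F g i j).
by rewrite -(F_mul g i ord0 j) (F_skew g ord0).
Qed.

End CosetCocycles.

Lemma cohomology1_trivialP (V : choiceType) (X : simplicial_complex V) (L : groupType) :
  (forall phi, @cocycle1 V X L phi ->
    exists chi : cochain0 X L, phi = gauge chi (fun=> 1%g)) ->
  cohomology1_trivial X L.
Proof.
have gaugeM (chi chi' : cochain0 X L) phi :
    gauge chi (gauge chi' phi) = gauge (fun v => chi v * chi' v)%g phi.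
  by apply/funext => e; rewrite /gauge invgM !mulgA.
have one_cocycle : @cocycle1 V X L (fun=> 1%g).
  by split=> [e|t] /=; rewrite ?invg1 ?mulg1.
move=> trivial; apply/seteqP; split=> [_ [phi /trivial[chi ->] <-]|_ ->]; last first.
  by exists (fun=> 1%g).
apply/seteqP; split=> [_ [chi' _ <-]|_ [chi' _ <-]].
  by rewrite gaugeM; eexists.
exists (fun v => chi' v * (chi v)^-1)%g => //; rewrite gaugeM.
by congr gauge; apply/funext => v; rewrite mulgVK.
Qed.

Theorem theorem6p1 (n p : nat) (hn : 3 <= n) (hp : prime p) (hodd : odd p)
    (L : groupType)
    (hL : ~ exists x : L, x <> 1%g /\ has_order x p) :
  cohomology1_trivial (X_np n p) L.
Proof.
apply: cohomology1_trivialP => phi phi_cocycle.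
have K_sub i : subgroup (@K_ n p i) by apply: generated_subgroup.
apply: (cocycle_is_coboundary K_sub phi_cocycle) => a.
apply: (sections_injective hn hp hodd (f := base (L := L))).
- exact/base_kernel_torsion/no_prime_torsion.
- by move=> i g h _ _; apply: transportM.
- by [].
- by move=> i j g; apply: transport_eq.
Qed.
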